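(* Let $k$ be a field of characteristic $0$ and let $\underline{\lambda}=[\lambda_1,\ldots,\lambda_r]$ be a pure tuple of partitions. Then: (a) There exists a countable $\underline{\lambda}$-space over $k$ that is both universal and homogeneous. (b) Any two universal homogeneous countable $\underline{\lambda}$-spaces over $k$ are isomorphic. (c) If $V$ is a universal homogeneous countable $\underline{\lambda}$-space over $k$ and $k'/k$ is any field extension, then $V\otimes_k k'$ (with the $k'$-linear extensions of the forms) is a universal homogeneous $\underline{\lambda}$-space over $k'$.
   Context: For a partition $\lambda$ of $n$, let $S^\lambda$ be the Specht module over $k$ (irreducible representation of the symmetric group $\mathfrak{S}_n$), and let $\mathbf{S}_\lambda(V)=\operatorname{Hom}_{\mathfrak{S}_n}(S^\lambda,V^{\otimes n})$ be the Schur functor. A $\lambda$-form on a $k$-vector space $V$ is a linear map $\mathbf{S}_\lambda(V)\to k$. A tuple $\underline{\lambda}=[\lambda_1,\ldots,\lambda_r]$ of partitions is pure if every $\lambda_i$ is non-empty. A $\underline{\lambda}$-structure on $V$ is a tuple $(\omega_1,\ldots,\omega_r)$ with $\omega_i$ a $\lambda_i$-form on $V$; a $\underline{\lambda}$-space is a vector space with a $\underline{\lambda}$-structure. An embedding $W\to V$ of $\underline{\lambda}$-spaces is an injective linear map along which the structure of $V$ pulls back to that of $W$; an isomorphism is a bijective embedding. ''Finite'' means finite-dimensional and ''countable'' means of countably infinite dimension. A $\underline{\lambda}$-space $V$ is universal if every finite $\underline{\lambda}$-space embeds into $V$, and homogeneous if, whenever $W,W'$ are finite-dimensional subspaces of $V$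 (with induced structures), every isomorphism $W\to W'$ of $\underline{\lambda}$-spaces extends to an automorphism of $V$. *)

(* Defs.v *)
From HB Require Import structures.
From mathcomp Require Import all_boot all_order all_fingroup all_algebra.
From mathcomp Require Import ring_quotient freeg boolp functions.
From mathcomp Require Import generic_quotient.

Set Implicit Arguments.
Unset Strict Implicit.
Unset Printing Implicit Defensive.

Import GRing.Theory.
Local Open Scope ring_scope.

Section Subspace.
Variables (R : nzRingType) (V : lmodType R) (W : submodClosed V).

Record subspace := Subspace { subspace_val : V; _ : subspace_val \in W }.

HB.instance Definition _ := [isSub for subspace_val].
HB.instance Definition _ := [Choice of subspace by <:].
HB.instance Definition _ := [SubChoice_isSubLmodule of subspace by <:].

End Subspace.

Definition finite_dim (R : nzRingType) (V : lmodType R) : Prop :=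
  exists n (e : 'I_n -> V), forall v, exists c : 'I_n -> R,
    v = \sum_i c i *: e i.

(* A basis indexed by nat: countably infinite dimension. *)
Definition countable_dim (R : nzRingType) (V : lmodType R) : Prop :=
  exists e : nat -> V,
    (forall v, exists n (c : nat -> R), v = \sum_(i < n) c i *: e i) /\
    (forall n (c : nat -> R), \sum_(i < n) c i *: e i = 0 ->
       forall i, (i < n)%N -> c i = 0).

Section Span.
Variables (R : nzRingType) (V : lmodType R) (P : V -> Prop).

Definition span_pred : {pred V} := fun v =>
  `[< exists n (c : 'I_n -> R) (u : 'I_n -> V),
        (forall i, P (u i)) /\ v = \sum_i c i *: u i >].

Lemma span_closed : subsemimod_closed span_pred.
Proof.
split; [split|].
- by apply/asboolP; exists 0%N, (fun=> 0), (fun=> 0); split=> [[]|]; rewrite ?big_ord0.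
- move=> x y /asboolP[n [c [u [Pu ->]]]] /asboolP[m [d [w [Pw ->]]]].
  apply/asboolP; exists (n + m)%N.
  exists (fun i => match fintype.split i with inl j => c j | inr j => d j end).
  exists (fun i => match fintype.split i with inl j => u j | inr j => w j end).
  split=> [i|]; first by case: (fintype.split i).
  rewrite big_split_ord; congr (_ + _); apply: eq_bigr => i _.
    by rewrite (unsplitK (inl i)).
  by rewrite (unsplitK (inr i)).
- move=> a x /asboolP[n [c [u [Pu ->]]]]; apply/asboolP.
  exists n, (fun i => a * c i), u; split=> //.
  by rewrite scaler_sumr; apply: eq_bigr => i _; rewrite scalerA.
Qed.

HB.instance Definition _ := GRing.isSubmodClosed.Build R V span_pred span_closed.

Lemma span_mem v : P v -> v \in span_pred.
Proof.
move=> Pv; apply/asboolP; exists 1%N, (fun=> 1), (fun=> v); split=> //.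
by rewrite big_ord1 scale1r.
Qed.

End Span.

Section Presented.
Variables (R : nzRingType) (X : choiceType) (rel : {freeg X / R} -> Prop).

Definition presented := Quotient.quot (span_pred rel).

HB.instance Definition _ := GRing.Zmodule.on presented.

Definition pres_pi (D : {freeg X / R}) : presented :=
  (\pi_(Quotient.quot (span_pred rel)) D)%qT.

Definition rep (x : presented) : {freeg X / R} :=
  repr (x : Quotient.quot (span_pred rel)).

Definition pres_scale (a : R) (x : presented) : presented :=
  pres_pi (a *: rep x).

Lemma pres_pi_eq D E : (pres_pi D == pres_pi E) = (D - E \in span_pred rel).
Proof. by rewrite /pres_pi -Quotient.idealrBE. Qed.

Lemma pres_piD D E : pres_pi (D + E) = pres_pi D + pres_pi E.
Proof. by rewrite /pres_pi raddfD. Qed.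

Lemma pres_repr (x : presented) : pres_pi (rep x) = x.
Proof. exact: reprK. Qed.

Lemma pres_piZ a D : pres_scale a (pres_pi D) = pres_pi (a *: D).
Proof.
apply/eqP; rewrite pres_pi_eq -scalerBr rpredZ // -pres_pi_eq.
by rewrite pres_repr.
Qed.

Lemma pres_scaleA a b x : pres_scale a (pres_scale b x) = pres_scale (a * b) x.
Proof. by rewrite -(pres_repr x) !pres_piZ scalerA. Qed.
Lemma pres_scale1 : left_id 1 pres_scale.
Proof. by move=> x; rewrite -(pres_repr x) !pres_piZ scale1r. Qed.
Lemma pres_scaleDr : right_distributive pres_scale +%R.
Proof.
move=> a x y; rewrite -(pres_repr x) -(pres_repr y).
by rewrite -pres_piD !pres_piZ scalerDr pres_piD.
Qed.
Lemma pres_scaleDl x : {morph pres_scale^~ x : a b / a + b}.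
Proof. by move=> a b; rewrite -(pres_repr x) !pres_piZ scalerDl pres_piD. Qed.

HB.instance Definition _ := GRing.Zmodule_isLmodule.Build R presented
  pres_scaleA pres_scale1 pres_scaleDr pres_scaleDl.

Definition pres_gen (x : X) : presented := pres_pi << x >>.

Lemma pres_gen_ind (P : presented -> Prop) : P 0 -> (forall x, P (pres_gen x)) ->
  (forall a x y, P x -> P y -> P (a *: x + y)) -> forall y, P y.
Proof.
move=> P0 Pgen PD y; rewrite -(pres_repr y) -[rep _]freeg_sumE /pres_pi raddf_sum.
elim/big_rec: _ => // z u _ Pu.
have -> : << coeff z (rep y) *g z >> = coeff z (rep y) *: << z >> :> {freeg X / R}.
  by apply/eqP/freeg_eqP=> w; rewrite coeffZ !coeffU mul1r.
by rewrite -[X in X + _]/(pres_pi _) -pres_piZ; exact: (PD _ (pres_gen z) _ (Pgen z) Pu).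
Qed.

End Presented.

Section Lift.
Variables (R R' : nzRingType) (h : {rmorphism R -> R'}) (X : choiceType).
Variables (M : lmodType R') (m : X -> M).

Definition free_lift (D : {freeg X / R}) : M :=
  \sum_(x <- dom D) h (coeff x D) *: m x.

Lemma free_liftE s D : uniq s -> {subset dom D <= s} ->
  free_lift D = \sum_(x <- s) h (coeff x D) *: m x.
Proof.
move=> us sub; rewrite /free_lift.
rewrite [RHS](bigID (mem (dom D))) /= [X in _ + X]big1 ?addr0; last first.
  by move=> i Ni; rewrite coeff_outdom // rmorph0 scale0r.
rewrite -[RHS]big_filter; apply: perm_big; apply: uniq_perm.
- exact: uniq_dom.
- exact: filter_uniq.
- move=> x; rewrite mem_filter /=; apply/idP/andP=> [xD|[]//].
  by split=> //; apply: sub.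
Qed.

Lemma free_lift_semilinear a D E :
  free_lift (a *: D + E) = h a *: free_lift D + free_lift E.
Proof.
pose s := undup (dom (a *: D + E) ++ dom D ++ dom E).
have us : uniq s by exact: undup_uniq.
rewrite !(@free_liftE s) //; try by move=> x xD; rewrite mem_undup !mem_cat xD ?orbT.
rewrite scaler_sumr -big_split /=; apply: eq_bigr => x _.
by rewrite coeffD coeffZ rmorphD rmorphM scalerDl scalerA.
Qed.

Lemma free_lift0 : free_lift 0 = 0.
Proof.
by have /eqP := free_lift_semilinear 1 0 0;
  rewrite scale1r addr0 rmorph1 scale1r -subr_eq0 opprD addrA subrr sub0r
          oppr_eq0 => /eqP.
Qed.

Lemma free_lift_sum n (c : 'I_n -> R) (u : 'I_n -> {freeg X / R}) :
  free_lift (\sum_i c i *: u i) = \sum_i h (c i) *: free_lift (u i).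
Proof.
elim/big_rec2: _ => [|i y D _ <-]; first exact: free_lift0.
exact: free_lift_semilinear.
Qed.

Lemma free_liftU x : free_lift << x >> = m x.
Proof.
rewrite (@free_liftE [:: x]) //; last by move=> y; rewrite domU1.
by rewrite big_seq1 coeffU eqxx mulr1 rmorph1 scale1r.
Qed.

Variable rel : {freeg X / R} -> Prop.

(* The h-semilinear map sending pres_gen x to m x.  It is given by a formula on
   representatives, so that it is meaningful only if m respects the
   relations; see pres_lift_gen and pres_lift_semilinear. *)
Definition pres_lift (x : presented rel) : M := free_lift (rep x).

Hypothesis m_rel : forall D, rel D -> free_lift D = 0.

Lemma pres_lift_pi D : pres_lift (pres_pi rel D) = free_lift D.
Proof.
have zero E : E \in span_pred rel -> free_lift E = 0.
  move=> /asboolP[n [c [u [Pu ->]]]]; rewrite free_lift_sum big1 // => i _.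
  by rewrite m_rel ?scaler0.
set E := rep (pres_pi rel D).
have /zero : E - D \in span_pred rel by rewrite -pres_pi_eq pres_repr.
rewrite addrC -scaleN1r free_lift_semilinear rmorphN1 scaleN1r addrC => /eqP.
by rewrite subr_eq0 => /eqP.
Qed.

Lemma pres_lift_gen x : pres_lift (pres_gen rel x) = m x.
Proof. by rewrite pres_lift_pi free_liftU. Qed.

Lemma pres_lift_semilinear a x y : pres_lift (a *: x + y) = h a *: pres_lift x + pres_lift y.
Proof.
rewrite -(pres_repr x) -(pres_repr y).
have -> : a *: pres_pi rel (rep x) + pres_pi rel (rep y)
  = pres_pi rel (a *: rep x + rep y).
  by rewrite pres_piD -pres_piZ.
by rewrite !pres_lift_pi free_lift_semilinear.
Qed.

End Lift.


Section TensorPower.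
Variables (k : fieldType) (n : nat).

Definition upd (T : Type) (v : {ffun 'I_n -> T}) (i : 'I_n) (x : T) :
  {ffun 'I_n -> T} := [ffun j => if j == i then x else v j].

Definition tens_rel (V : lmodType k) (D : {freeg {ffun 'I_n -> V} / k}) : Prop :=
  exists v i a x y, D = << upd v i (a *: x + y) >>
    - (a *: << upd v i x >> + << upd v i y >>).

Definition tpow (V : lmodType k) : lmodType k := presented (@tens_rel V).

Definition tens (V : lmodType k) (v : {ffun 'I_n -> V}) : tpow V :=
  pres_gen (@tens_rel V) v.

Definition multilinear (k' : fieldType) (h : {rmorphism k -> k'})
    (V : lmodType k) (M : lmodType k') (m : {ffun 'I_n -> V} -> M) : Prop :=
  forall v i a x y,
    m (upd v i (a *: x + y)) = h a *: m (upd v i x) + m (upd v i y).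

Lemma tensD (V : lmodType k) (v : {ffun 'I_n -> V}) i a x y :
  tens (upd v i (a *: x + y)) = a *: tens (upd v i x) + tens (upd v i y).
Proof.
apply/eqP; rewrite /tens /pres_gen.
have -> : a *: pres_pi (@tens_rel V) << upd v i x >>
    + pres_pi (@tens_rel V) << upd v i y >>
  = pres_pi (@tens_rel V) (a *: << upd v i x >> + << upd v i y >>).
  by rewrite pres_piD -pres_piZ.
by rewrite pres_pi_eq; apply: span_mem; exists v, i, a, x, y.
Qed.

Section TensorLift.
Variables (k' : fieldType) (h : {rmorphism k -> k'}) (V : lmodType k).
Variables (M : lmodType k') (m : {ffun 'I_n -> V} -> M).

Definition tpow_lift : tpow V -> M := pres_lift h m (rel := @tens_rel V).

Hypothesis mP : multilinear h m.

Lemma tens_rel_lift D : tens_rel D -> free_lift h m D = 0.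
Proof.
move=> [v [i [a [x [y ->]]]]].
rewrite addrC -scaleN1r free_lift_semilinear rmorphN1 scaleN1r.
by rewrite free_lift_semilinear !free_liftU mP addNr.
Qed.

Lemma tpow_lift_tens v : tpow_lift (tens v) = m v.
Proof. exact: pres_lift_gen tens_rel_lift v. Qed.

Lemma tpow_lift_semilinear a x y :
  tpow_lift (a *: x + y) = h a *: tpow_lift x + tpow_lift y.
Proof. exact: pres_lift_semilinear tens_rel_lift a x y. Qed.

End TensorLift.

Lemma tens_ind (V : lmodType k) (P : tpow V -> Prop) : P 0 -> (forall v, P (tens v)) ->
  (forall a x y, P x -> P y -> P (a *: x + y)) -> forall y, P y.
Proof. exact: pres_gen_ind. Qed.

(* The left action of permutations on n-tuples, (s.v)_(s j) = v_j. *)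
Definition tuple_act (T : Type) (s : {perm 'I_n}) (v : {ffun 'I_n -> T}) :
  {ffun 'I_n -> T} := [ffun j => v ((s^-1)%g j)].

Definition tpow_act (V : lmodType k) (s : {perm 'I_n}) : tpow V -> tpow V :=
  tpow_lift idfun (fun v => tens (tuple_act s v)).

Lemma tuple_act_upd T s (v : {ffun 'I_n -> T}) i x :
  tuple_act s (upd v i x) = upd (tuple_act s v) (s i) x.
Proof.
apply/ffunP=> j; rewrite !ffunE.
by rewrite -(inj_eq (@perm_inj _ s) ((s^-1)%g j)) permKV.
Qed.

Lemma tpow_act_multilinear (V : lmodType k) s :
  @multilinear k idfun V (tpow V) (fun v => tens (tuple_act s v)).
Proof. by move=> v i a x y; rewrite !tuple_act_upd tensD. Qed.

Lemma tpow_act_tens (V : lmodType k) s (v : {ffun 'I_n -> V}) :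
  tpow_act s (tens v) = tens (tuple_act s v).
Proof. exact: tpow_lift_tens (@tpow_act_multilinear V s) v. Qed.

Lemma tpow_act_linear (V : lmodType k) s : linear (@tpow_act V s).
Proof. exact: tpow_lift_semilinear (@tpow_act_multilinear V s). Qed.

HB.instance Definition _ V s := GRing.isLinear.Build k (tpow V) (tpow V) _
  (@tpow_act V s) (@tpow_act_linear V s).

Section TensorMap.
Variables (V W : lmodType k) (f : {linear V -> W}).

Definition tpow_map : tpow V -> tpow W :=
  tpow_lift idfun (fun v : {ffun 'I_n -> V} => tens [ffun j => f (v j)]).

Lemma ffun_upd i x (v : {ffun 'I_n -> V}) :
  [ffun j => f (upd v i x j)] = upd [ffun j => f (v j)] i (f x).
Proof. by apply/ffunP=> j; rewrite !ffunE; case: ifP. Qed.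

Lemma tpow_map_multilinear :
  multilinear idfun (fun v : {ffun 'I_n -> V} => tens [ffun j => f (v j)]).
Proof. by move=> v i a x y; rewrite !ffun_upd linearP tensD. Qed.

Lemma tpow_map_tens v : tpow_map (tens v) = tens [ffun j => f (v j)].
Proof. exact: tpow_lift_tens tpow_map_multilinear v. Qed.

Lemma tpow_map_linear : linear tpow_map.
Proof. exact: tpow_lift_semilinear tpow_map_multilinear. Qed.

HB.instance Definition _ := GRing.isLinear.Build k (tpow V) (tpow W) _
  tpow_map tpow_map_linear.

Lemma tpow_map_act s x : tpow_map (tpow_act s x) = tpow_act s (tpow_map x).
Proof.
elim/tens_ind: x => [|v|a x y IHx IHy].
- by rewrite !linear0.
- rewrite tpow_act_tens !tpow_map_tens tpow_act_tens; congr tens.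
  by apply/ffunP=> j; rewrite !ffunE.
- rewrite (tpow_act_linear s a x y) !tpow_map_linear IHx IHy.
  by rewrite tpow_act_linear.
Qed.

End TensorMap.

End TensorPower.

(* To be used through the lemmas above: unfolding the quotients makes
   unification and conversion very slow. *)
#[global] Opaque tpow tens tpow_lift tpow_act tpow_map.

Record intpart := IntPart {
  parts :> seq nat;
  partsP : sorted geq parts && (0%N \notin parts) }.

Section Specht.
Variables (k : fieldType) (lam : intpart).

Local Notation n := (sumn lam).

(* Tableaux are fillings of the diagram by 'I_n; the reference tableau is
   filled row by row.  Any other one is obtained from it by renumbering the
   entries through a permutation. *)
Definition row_of : {ffun 'I_n -> 'I_(size lam)} :=
  [ffun j : 'I_n => Ordinal (reshape_indexP (ltn_ord j))].
Definition col_of (j : 'I_n) : nat := reshape_offset lam j.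

(* A tabloid is given by the row in which each entry lies; functions whose
   fibres have the wrong size do not occur in the polytabloids. *)
Definition tabloid := {ffun 'I_n -> 'I_(size lam)}.

Definition tabloid_space := {ffun tabloid -> k^o}.
HB.instance Definition _ := Vector.on tabloid_space.

Definition tabloid_vect (t : tabloid) : tabloid_space :=
  [ffun u => (u == t)%:R].

Definition column_stabiliser : {set {perm 'I_n}} :=
  [set q : {perm 'I_n} | [forall j, col_of (q j) == col_of j]].

(* The polytabloid of the reference tableau renumbered by s. *)
Definition polytabloid (s : {perm 'I_n}) : tabloid_space :=
  \sum_(q in column_stabiliser)
     (-1) ^+ odd_perm q *: tabloid_vect (tuple_act s (tuple_act q row_of)).

Definition specht : {vspace tabloid_space} :=
  <<[seq polytabloid s | s : {perm 'I_n}]>>%VS.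

Definition tabloid_act (s : {perm 'I_n}) (x : tabloid_space) : tabloid_space :=
  [ffun u => x (tuple_act (s^-1)%g u)].

Lemma tabloid_act_linear s : linear (tabloid_act s).
Proof. by move=> a x y; apply/ffunP=> u; rewrite !ffunE. Qed.

HB.instance Definition _ s := GRing.isLinear.Build k tabloid_space tabloid_space _
  (tabloid_act s) (tabloid_act_linear s).

Lemma tuple_actM T s s' (v : {ffun 'I_n -> T}) :
  tuple_act s (tuple_act s' v) = tuple_act (s' * s)%g v.
Proof. by apply/ffunP=> j; rewrite !ffunE invMg permM. Qed.

Lemma tuple_act1 T (v : {ffun 'I_n -> T}) : tuple_act 1%g v = v.
Proof. by apply/ffunP=> j; rewrite !ffunE invg1 perm1. Qed.

Lemma tabloid_act_vect s t :
  tabloid_act s (tabloid_vect t) = tabloid_vect (tuple_act s t).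
Proof.
apply/ffunP=> u; rewrite !ffunE; congr (_%:R : k); congr nat_of_bool.
apply/eqP/eqP=> [<-|->]; rewrite tuple_actM.
  by rewrite mulVg tuple_act1.
by rewrite mulgV tuple_act1.
Qed.

Lemma tabloid_act_poly s s' :
  tabloid_act s (polytabloid s') = polytabloid (s' * s)%g.
Proof.
rewrite /polytabloid linear_sum; apply: eq_bigr => q _.
by rewrite linearZ /= tabloid_act_vect tuple_actM.
Qed.

Lemma specht_stable s x : x \in specht -> tabloid_act s x \in specht.
Proof.
move=> /coord_span ->; rewrite linear_sum; apply: rpred_sum => i _.
rewrite linearZ; apply: rpredZ.
have ltis : (i < size [seq polytabloid s0 | s0 : {perm 'I_n}])%N.
  by rewrite size_image ltn_ord.
have /imageP[s' _ ->] := mem_nth 0 ltis.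
by rewrite /= tabloid_act_poly; apply: memv_span; apply: image_f.
Qed.

(* The action on the Specht module; vsproj only retypes, by specht_stable. *)
Definition specht_act (s : {perm 'I_n}) (x : subvs_of specht) : subvs_of specht :=
  vsproj specht (tabloid_act s (vsval x)).

Lemma specht_actE s x : vsval (specht_act s x) = tabloid_act s (vsval x).
Proof. by rewrite vsprojK // specht_stable // subvsP. Qed.

End Specht.

Section Schur.
Variables (k : fieldType) (lam : intpart).

Local Notation n := (sumn lam).
Local Notation S := (subvs_of (specht k lam)).

Definition schur_pred (V : lmodType k) : {pred (S -> tpow n V)} := fun phi =>
  `[< linear phi /\ forall s x, phi (specht_act s x) = tpow_act s (phi x) >].

Lemma schur_closed V : subsemimod_closed (@schur_pred V).
Proof.
split; [split|].
- by apply/asboolP; split=> [a x y|s x] /=; rewrite ?scaler0 ?addr0 ?linear0.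
- move=> f g /asboolP[fl fe] /asboolP[gl ge]; apply/asboolP; split=> [a x y|s x].
    by rewrite /= !addrfctE fl gl scalerDr addrACA.
  by rewrite /= !addrfctE fe ge linearD.
- move=> c f /asboolP[fl fe]; apply/asboolP; split=> [a x y|s x].
    by rewrite !scalrfctE fl scalerDr !scalerA mulrC.
  by rewrite !scalrfctE fe linearZ.
Qed.

HB.instance Definition _ V := GRing.isSubmodClosed.Build k (S -> tpow n V)
  (@schur_pred V) (schur_closed V).

Definition schur (V : lmodType k) : lmodType k := subspace (@schur_pred V).

Section SchurMap.
Variables (V W : lmodType k) (f : {linear V -> W}).

Lemma schur_map_subproof (phi : schur V) :
  (fun x => tpow_map f (val phi x)) \in @schur_pred W.
Proof.
have /asboolP[lin equi] := valP phi; apply/asboolP; split=> [a x y|s x].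
  by rewrite lin linearP.
by rewrite equi tpow_map_act.
Qed.

Definition schur_map (phi : schur V) : schur W := Subspace (schur_map_subproof phi).

Lemma schur_map_linear : linear schur_map.
Proof.
move=> a x y; apply/val_inj; apply/funext=> u.
have valP' (U : lmodType k) (p q : schur U) : val (a *: p + q) = a *: val p + val q.
  exact: linearP.
rewrite valP'.
exact: etrans (congr1 (fun g => tpow_map f (g u)) (valP' V x y))
  (tpow_map_linear f a (val x u) (val y u)).
Qed.

HB.instance Definition _ := GRing.isLinear.Build k (schur V) (schur W) _
  schur_map schur_map_linear.

End SchurMap.

End Schur.

Section LambdaSpaces.
Variables (k : fieldType) (r : nat) (lam : r.-tuple intpart).

Definition lstructure (V : lmodType k) :=
  forall i : 'I_r, {scalar schur (tnth lam i) V}.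

Record lspace := LSpace {
  carrier :> lmodType k;
  omega : lstructure carrier }.

Definition pullback (V W : lmodType k) (f : {linear W -> V}) (w : lstructure V) :
  lstructure W := fun i => w i \o schur_map f.

Definition embedding (W V : lspace) (f : {linear W -> V}) : Prop :=
  injective f /\ forall i, pullback f (omega V) i =1 omega W i.

Definition isomorphism (W V : lspace) (f : {linear W -> V}) : Prop :=
  bijective f /\ embedding f.

Definition induced (V : lspace) (W : submodClosed V) : lspace :=
  @LSpace (subspace W) (pullback (val : {linear subspace W -> V}) (omega V)).

Definition universal (V : lspace) : Prop :=
  forall W : lspace, finite_dim W -> exists f : {linear W -> V}, embedding f.

Definition homogeneous (V : lspace) : Prop :=
  forall W W' : submodClosed V,
    finite_dim (subspace W) -> finite_dim (subspace W') ->
    forall g : {linear induced W -> induced W'}, isomorphism g ->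
    exists h : {linear V -> V},
      isomorphism h /\ forall w : subspace W, h (val w) = val (g w).

End LambdaSpaces.

Section ScalarExtension.
Variables (k k' : fieldType) (h : {rmorphism k -> k'}).

Section Module.
Variable V : lmodType k.

Definition scext_rel (D : {freeg V / k'}) : Prop :=
  exists (a : k) x y, D = << a *: x + y >> - (h a *: << x >> + << y >>).

(* Base change of V along h, as the k'-vector space generated by the vectors
   v (x) 1, with v in V, subject to k-linearity in v. *)
Definition scext : lmodType k' := presented scext_rel.

Definition scext_in (v : V) : scext := pres_gen scext_rel v.

Lemma scext_in_semilinear a x y :
  scext_in (a *: x + y) = h a *: scext_in x + scext_in y.
Proof.
apply/eqP; rewrite /scext_in /pres_gen.
have -> : h a *: pres_pi scext_rel << x >> + pres_pi scext_rel << y >>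
  = pres_pi scext_rel (h a *: << x >> + << y >>).
  by rewrite pres_piD -pres_piZ.
by rewrite pres_pi_eq; apply: span_mem; exists a, x, y.
Qed.

Section Lift.
Variables (M : lmodType k') (f : V -> M).
Hypothesis fP : forall a x y, f (a *: x + y) = h a *: f x + f y.

Definition scext_lift : scext -> M := pres_lift idfun f (rel := scext_rel).

Lemma scext_rel_lift D : scext_rel D -> free_lift idfun f D = 0.
Proof.
move=> [a [x [y ->]]].
rewrite addrC -scaleN1r free_lift_semilinear rmorphN1 scaleN1r.
by rewrite free_lift_semilinear !free_liftU fP addNr.
Qed.

Lemma scext_lift_in v : scext_lift (scext_in v) = f v.
Proof. exact: pres_lift_gen scext_rel_lift v. Qed.

Lemma scext_lift_linear : linear scext_lift.
Proof. exact: pres_lift_semilinear scext_rel_lift. Qed.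

End Lift.

Lemma scext_ind (P : scext -> Prop) : P 0 -> (forall v, P (scext_in v)) ->
  (forall a x y, P x -> P y -> P (a *: x + y)) -> forall y, P y.
Proof. exact: pres_gen_ind. Qed.

Section Tensor.
Variable n : nat.

Definition tpow_scext : tpow n V -> tpow n scext :=
  tpow_lift h (fun v : {ffun 'I_n -> V} => tens [ffun j => scext_in (v j)]).

Lemma tpow_scext_multilinear :
  multilinear h (fun v : {ffun 'I_n -> V} => tens [ffun j => scext_in (v j)]).
Proof.
have updE i x (v : {ffun 'I_n -> V}) :
  [ffun j => scext_in (upd v i x j)] = upd [ffun j => scext_in (v j)] i (scext_in x).
  by apply/ffunP=> j; rewrite !ffunE; case: ifP.
by move=> v i a x y; rewrite !updE scext_in_semilinear tensD.
Qed.

Lemma tpow_scext_tens v :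
  tpow_scext (tens v) = tens [ffun j => scext_in (v j)].
Proof. exact: tpow_lift_tens tpow_scext_multilinear v. Qed.

Lemma tpow_scext_semilinear a x y :
  tpow_scext (a *: x + y) = h a *: tpow_scext x + tpow_scext y.
Proof. exact: tpow_lift_semilinear tpow_scext_multilinear a x y. Qed.

End Tensor.

End Module.

Section SpechtExtension.
Variable lam : intpart.

Definition tabloid_scext (x : tabloid_space k lam) : tabloid_space k' lam :=
  [ffun t => h (x t)].

Lemma tabloid_scext_poly s :
  tabloid_scext (polytabloid k s) = polytabloid k' s :> tabloid_space k' lam.
Proof.
apply/ffunP=> t; rewrite ffunE !sum_ffunE rmorph_sum; apply: eq_bigr => q _.
rewrite !ffunE [LHS]rmorphM /= rmorphXn /= rmorphN1; congr (_ * _).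
exact: rmorph_nat.
Qed.

Lemma tabloid_scext_mem x : x \in specht k lam -> tabloid_scext x \in specht k' lam.
Proof.
have scextP a y z : tabloid_scext (a *: y + z) = h a *: tabloid_scext y + tabloid_scext z.
  by apply/ffunP=> t; rewrite !ffunE rmorphD rmorphM.
move=> /coord_span ->; elim/big_rec: _ => [|i y _ IHy].
  have -> : tabloid_scext 0 = 0 by apply/ffunP=> t; rewrite !ffunE rmorph0.
  exact: mem0v.
rewrite scextP; apply: rpredD => //; apply: rpredZ.
have ltis : (i < size [seq polytabloid k s | s : {perm 'I_(sumn lam)}])%N.
  by rewrite size_image ltn_ord.
have /imageP[s' _ ->] := mem_nth 0 ltis.
by rewrite tabloid_scext_poly; apply: memv_span; apply: image_f.
Qed.

Definition specht_scext (x : subvs_of (specht k lam)) : subvs_of (specht k' lam) :=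
  vsproj _ (tabloid_scext (vsval x)).

Lemma specht_scextE x : vsval (specht_scext x) = tabloid_scext (vsval x).
Proof. by rewrite vsprojK // tabloid_scext_mem // subvsP. Qed.

(* The map S_lam(V) -> S_lam(V (x) k') sends phi to the unique phi' such that
   phi' (x (x) 1) = (phi x) (x) 1; it is stated as a relation. *)
Definition schur_scext (V : lmodType k) (phi : schur lam V)
    (phi' : schur lam (scext V)) : Prop :=
  forall x, val phi' (specht_scext x) = tpow_scext (val phi x).

End SpechtExtension.

(* w' is the k'-linear extension of w: it is k'-linear by its type, and it
   agrees with w on S_lam(V). *)
Definition scext_structure (r : nat) (lam : r.-tuple intpart) (V : lmodType k)
    (w : lstructure lam V) (w' : lstructure lam (scext V)) : Prop :=
  forall i phi phi', schur_scext phi phi' -> w' i phi' = h (w i phi).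

End ScalarExtension.

#[global] Opaque scext scext_in scext_lift tpow_scext.

Arguments scext_structure {k k'} h {r lam V} w w'.

(* Main.v *)
(* A lambda-form w on V is determined by an n-linear form mform w, obtained by
   averaging over the symmetric group, and conversely every n-linear form m
   gives a lambda-form schur_form m, by evaluating the elements of S_lambda(V)
   at a cyclic generator of the Specht module; both are natural in V and
   schur_form (mform w) = w.  So it mostly suffices to extend multilinear forms.

   Call V extensible if every isometry between finite-dimensional subspaces of
   a lambda-space W and of V extends to any further vector of W.  Universal
   homogeneous spaces are extensible, and by back-and-forth an isometry between
   finite-dimensional subspaces of two extensible spaces of countable dimension
   extends to an isomorphism; this gives uniqueness and homogeneity.

   For existence, n-linear forms on k[X] are given by their values on tuples of
   monomials.  In the model these values are 0 or 1, and chosen so that, for all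
   N, all ways to extend the form by one vector v to span(1, ..., X^(N-1)) + k v
   are realised by polynomials: a value tau at a tuple containing v at the
   places A is produced by fresh monomials, one for each place in A and used
   only there, with coefficients of product tau.  As the model has 0-1 values,
   it is compatible with extension of scalars, whence (c). *)

Require Import Defs.
From HB Require Import structures.
From mathcomp Require Import all_boot all_order all_fingroup all_algebra.
From mathcomp Require Import boolp functions.

Set Implicit Arguments.
Unset Strict Implicit.
Unset Printing Implicit Defensive.

Import GRing.Theory.
Local Open Scope ring_scope.

Lemma semilinear0 (k k' : nzRingType) (h : {rmorphism k -> k'}) (U : lmodType k)
    (M : lmodType k') (f : U -> M) :
  (forall a x y, f (a *: x + y) = h a *: f x + f y) -> f 0 = 0.
Proof. by move=> /(_ (-1) 0 0); rewrite rmorphN1 !scaleN1r !addNr. Qed.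

(** * Lambda-forms as multilinear forms *)

Section Splitting.
Variables (k : fieldType) (lam : intpart).
Local Notation n := (sumn lam).
Implicit Type c : {perm 'I_n} -> tabloid lam -> k.

Definition tabloid_form c s (x : tabloid_space k lam) : k := \sum_t c s t * x t.

Lemma tabloid_form_linear c s a x y :
  tabloid_form c s (a *: x + y) = a * tabloid_form c s x + tabloid_form c s y.
Proof.
rewrite /tabloid_form mulr_sumr -big_split /=; apply: eq_bigr => t _.
by rewrite !ffunE mulrDr mulrCA.
Qed.

Lemma tabloid_form0 c s : tabloid_form c s 0 = 0.
Proof. by rewrite /tabloid_form big1 // => t _; rewrite ffunE mulr0. Qed.

(* The forms with matrix c give a linear section of the map from k[S_n] onto the
   Specht module.  A matrix, unlike coord, can be mapped to an extension of k. *)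
Definition splits c := forall s0, polytabloid k s0 =
  \sum_s tabloid_form c s (polytabloid k s0) *: polytabloid k s :> tabloid_space k lam.

Lemma specht_ind (P : tabloid_space k lam -> Prop) : P 0 ->
  (forall a s x, P x -> P (a *: polytabloid k s + x)) ->
  forall x, x \in specht k lam -> P x.
Proof.
move=> P0 PD x /coord_span ->; elim/big_rec: _ => // i y _ Py.
have ltis : (i < size [seq polytabloid k s | s : {perm 'I_n}])%N.
  by rewrite size_image ltn_ord.
by have /imageP[s _ ->] := mem_nth 0 ltis; apply: PD.
Qed.

Lemma splitsE c x : splits c -> x \in specht k lam ->
  x = \sum_s tabloid_form c s x *: polytabloid k s.
Proof.
move=> cP; elim/specht_ind => [|a s y IHy].
  by rewrite big1 // => s _; rewrite tabloid_form0 scale0r.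
under eq_bigr do rewrite tabloid_form_linear scalerDl -scalerA.
by rewrite big_split -scaler_sumr /= -cP -IHy.
Qed.

(** The coordinates along the spanning family of all polytabloids are linear functionals on the
    whole tabloid space, so their values at single tabloids form such a matrix. *)
Lemma splits_exists : exists c, splits c.
Proof.
pose X := codom_tuple (fun s : {perm 'I_n} => polytabloid k s : tabloid_space k lam).
exists (fun s t => coord X (enum_rank s) (tabloid_vect k t)) => s0.
have /coord_span {1}-> : polytabloid k s0 \in <<X>>%VS.
  by apply: memv_span; apply: codom_f.
rewrite (reindex_onto enum_rank enum_val) /=; last by move=> i _; rewrite enum_valK.
rewrite (eq_bigl xpredT) => [|s]; last by rewrite enum_rankK eqxx.
apply: eq_bigr => s _; congr (_ *: _); last by rewrite nth_codom enum_rankK.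
have {1}-> : polytabloid k s0 = \sum_t polytabloid k s0 t *: tabloid_vect k t.
  apply/ffunP=> u; rewrite [RHS]sum_ffunE (bigD1 u) //= !ffunE eqxx.
  rewrite [X in _ + X]big1 ?addr0 => [|t /negPf ne]; last first.
    by rewrite !ffunE eq_sym ne; apply: mulr0.
  by apply/esym/mulr1.
rewrite linear_sum; apply: eq_bigr => t _.
by rewrite linearZ /= mulrC.
Qed.

End Splitting.

(** * Projection from tensors onto the Schur functor *)

Section SchurForms.
Variables (k : fieldType) (lam : intpart).
Local Notation n := (sumn lam).
Local Notation S := (subvs_of (specht k lam)).

Lemma tpow_actM (V : lmodType k) s s' (t : tpow n V) :
  tpow_act s (tpow_act s' t) = tpow_act (s' * s)%g t.
Proof.
elim/tens_ind: t => [|v|a x y IHx IHy]; first by rewrite !linear0.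
  by rewrite !tpow_act_tens tuple_actM.
by rewrite !linearP /= IHx IHy.
Qed.

(** The translates of this vector are all the polytabloids, so it generates the Specht module under
    the symmetric group. *)
Definition specht_gen : S := vsproj _ (polytabloid k 1).

Lemma specht_act_gen s : vsval (specht_act s specht_gen) = polytabloid k s.
Proof.
rewrite specht_actE /specht_gen vsprojK ?tabloid_act_poly ?mul1g //.
by apply: memv_span; apply: image_f.
Qed.

Lemma schur_linear (V : lmodType k) (p : schur lam V) : linear (val p).
Proof. by have /asboolP[] := valP p. Qed.

Lemma schur_equiv (V : lmodType k) (p : schur lam V) s x :
  val p (specht_act s x) = tpow_act s (val p x).
Proof. by have /asboolP[_ ->] := valP p. Qed.

Lemma schur_valP (V : lmodType k) a (p q : schur lam V) :
  val (a *: p + q) = a *: val p + val q.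
Proof. exact: linearP. Qed.

Lemma schur_sum (V : lmodType k) (p : schur lam V) (I : finType) (a : I -> k) (x : I -> S) :
  val p (\sum_i a i *: x i) = \sum_i a i *: val p (x i).
Proof.
have pL := schur_linear p.
elim/big_rec2: _ => [|i y z _ <-]; last by rewrite pL.
exact: (semilinear0 (h := idfun)).
Qed.

Section Project.
Variables (c : {perm 'I_n} -> tabloid lam -> k) (V : lmodType k).

(** Maschke averaging: the linear map sending [x] to the sum over [s] of [tabloid_form c s x] times
    [s t] is conjugated by [g] and averaged over [g], which makes it equivariant. *)
Definition schur_proj_fun (t : tpow n V) (x : S) : tpow n V :=
  (#|{perm 'I_n}|%:R)^-1 *: \sum_g \sum_s
    tabloid_form c s (tabloid_act (g^-1)%g (vsval x)) *: tpow_act (s * g)%g t.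

Lemma schur_proj_subproof t : schur_proj_fun t \in @schur_pred k lam V.
Proof.
apply/asboolP; split=> [a x y|h x]; rewrite /schur_proj_fun.
  rewrite !scaler_sumr -big_split /=; apply: eq_bigr => g _.
  rewrite !scaler_sumr -big_split /=; apply: eq_bigr => s _.
  by rewrite !linearP /= tabloid_form_linear scalerDl scalerDr !scalerA mulrCA mulrA.
rewrite linearZ; congr (_ *: _); rewrite [RHS]linear_sum /=.
rewrite (reindex_inj (mulIg h)); apply: eq_bigr => g _.
rewrite linear_sum; apply: eq_bigr => s _.
rewrite linearZ /= tpow_actM mulgA; congr (tabloid_form _ _ _ *: _).
rewrite specht_actE; apply/ffunP=> u; rewrite !ffunE tuple_actM; congr (vsval x _).
by rewrite !invMg !invgK mulgK.
Qed.

Definition schur_proj t : schur lam V := Subspace (schur_proj_subproof t).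

Lemma schur_projE t x : val (schur_proj t) x = schur_proj_fun t x.
Proof. by []. Qed.

Lemma schur_proj_linear : linear schur_proj.
Proof.
move=> a t u; apply/val_inj; apply/funext=> x.
rewrite schur_valP.
change (schur_proj_fun (a *: t + u) x = a *: schur_proj_fun t x + schur_proj_fun u x).
rewrite /schur_proj_fun !scaler_sumr -big_split /=; apply: eq_bigr => g _.
rewrite !scaler_sumr -big_split /=; apply: eq_bigr => s _.
by rewrite !linearP /= !scalerA.
Qed.

HB.instance Definition _ := GRing.isLinear.Build k (tpow n V) (schur lam V) _
  schur_proj schur_proj_linear.

Hypotheses (cP : splits c) (G0 : #|{perm 'I_n}|%:R != 0 :> k).

(** With [t] the value of [p] at the generator, the linear map being averaged is already [p],
    because [c] gives a section; by equivariance every term of the average equals [p x]. Hence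
    [schur_proj] is onto. *)
Lemma schur_projK (p : schur lam V) : schur_proj (val p specht_gen) = p.
Proof.
apply/val_inj; apply/funext=> x; rewrite schur_projE /schur_proj_fun.
suff E g : \sum_s tabloid_form c s (tabloid_act (g^-1)%g (vsval x)) *:
    tpow_act (s * g)%g (val p specht_gen) = val p x.
  under eq_bigr do rewrite E.
  by rewrite sumr_const -scaler_nat scalerA mulVf ?scale1r.
transitivity (tpow_act g (val p (\sum_s
    tabloid_form c s (tabloid_act (g^-1)%g (vsval x)) *: specht_act s specht_gen))).
  rewrite schur_sum linear_sum; apply: eq_bigr => s _.
  by rewrite linearZ /= schur_equiv tpow_actM.
rewrite -schur_equiv; congr (val p _).
apply/val_inj; rewrite [LHS]specht_actE linear_sum /=.
have gx : tabloid_act (g^-1)%g (vsval x) \in specht k lam.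
  by rewrite specht_stable // subvsP.
transitivity (tabloid_act g (tabloid_act (g^-1)%g (vsval x))); last first.
  by apply/ffunP=> u; rewrite !ffunE tuple_actM mulgV tuple_act1.
congr tabloid_act; rewrite [RHS](splitsE cP gx); apply: eq_bigr => s _.
by rewrite specht_act_gen.
Qed.

End Project.

Lemma schur_map_proj c (V W : lmodType k) (f : {linear V -> W}) t :
  schur_map f (schur_proj c t) = schur_proj c (tpow_map f t).
Proof.
apply/val_inj; apply/funext=> x; rewrite /= /schur_proj_fun linearZ.
congr (_ *: _); rewrite [LHS]linear_sum; apply: eq_bigr => g _.
rewrite linear_sum; apply: eq_bigr => s _.
by rewrite linearZ /= tpow_map_act.
Qed.

Section SchurForm.
Variables (V : lmodType k) (m : {ffun 'I_n -> V} -> k^o).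
Hypothesis mP : multilinear idfun m.

(** The proof of multilinearity is an argument so that the linear structure declared below is
    inferred from the term itself. *)
Definition schur_form of multilinear idfun m := fun p : schur lam V =>
  tpow_lift idfun m (val p specht_gen) : k^o.

Lemma schur_form_linear : linear (schur_form mP).
Proof.
move=> a p q; rewrite /schur_form schur_valP.
exact: (tpow_lift_semilinear mP a (val p specht_gen)).
Qed.

HB.instance Definition _ := GRing.isLinear.Build k (schur lam V) k^o _
  (schur_form mP) schur_form_linear.

Lemma schur_formE p : schur_form mP p = tpow_lift idfun m (val p specht_gen).
Proof. by []. Qed.

End SchurForm.

Lemma tpow_lift_sum (k' : fieldType) (h : {rmorphism k -> k'}) (V : lmodType k)
    (M : lmodType k') (m : {ffun 'I_n -> V} -> M) (mP : multilinear h m)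
    (I : finType) (a : I -> k) (t : I -> tpow n V) :
  tpow_lift h m (\sum_i a i *: t i) = \sum_i h (a i) *: tpow_lift h m (t i).
Proof.
elim/big_rec2: _ => [|i y z _ <-]; last by rewrite tpow_lift_semilinear.
exact: semilinear0 (tpow_lift_semilinear mP).
Qed.

Lemma tens_upd_multilinear (k' : fieldType) (h : {rmorphism k -> k'}) (V : lmodType k)
    (M : lmodType k') (f : tpow n V -> M) :
  (forall a x y, f (a *: x + y) = h a *: f x + f y) -> multilinear h (fun v => f (tens v)).
Proof. by move=> fP v i a x y; rewrite tensD fP. Qed.

Section MForm.
Variable c : {perm 'I_n} -> tabloid lam -> k.
Hypotheses (cP : splits c) (G0 : #|{perm 'I_n}|%:R != 0 :> k).

Definition mform (V : lmodType k) (w : {scalar schur lam V}) (v : {ffun 'I_n -> V}) : k^o :=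
  w (schur_proj c (tens v)).

Lemma mform_multilinear (V : lmodType k) (w : {scalar schur lam V}) :
  multilinear idfun (mform w).
Proof.
apply: (tens_upd_multilinear (f := fun t => w (schur_proj c t) : k^o)) => a x y.
by rewrite !linearP.
Qed.

Lemma mform_inj (V : lmodType k) (w w' : {scalar schur lam V}) :
  mform w =1 mform w' -> w =1 w'.
Proof.
move=> E p; rewrite -(schur_projK cP G0 p).
elim/tens_ind: (val p specht_gen) => [|//|a x y Ex Ey].
  by rewrite !linear0.
by rewrite !linearP Ex Ey.
Qed.

(** As [schur_proj] is natural and [mform] is injective, compatibility of lambda-forms with a linear
    map can be tested on the multilinear forms. *)
Lemma mform_map (V W : lmodType k) (f : {linear W -> V}) (w : {scalar schur lam V})
    (w' : {scalar schur lam W}) :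
  (w \o schur_map f =1 w') <->
  forall v : {ffun 'I_n -> W}, mform w [ffun a => f (v a)] = mform w' v.
Proof.
have E (v : {ffun 'I_n -> W}) : mform w [ffun a => f (v a)] = mform (w \o schur_map f) v.
  by rewrite /mform /= schur_map_proj tpow_map_tens.
split=> [Ew v|Ew]; first by rewrite E; apply: Ew.
by apply: mform_inj => v; rewrite -E.
Qed.

Definition sym_coef (g s : {perm 'I_n}) : k := (#|{perm 'I_n}|%:R)^-1 *
  tabloid_form c s (tabloid_act (g^-1)%g (polytabloid k 1)).

(* schur_form is a retraction of mform, and symmetrize is the corresponding
   projection of the n-linear forms onto the image of mform. *)
Definition symmetrize (V : lmodType k) (m : {ffun 'I_n -> V} -> k^o)
    (v : {ffun 'I_n -> V}) : k^o :=
  \sum_g \sum_s sym_coef g s * m (tuple_act (s * g)%g v).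

Lemma schur_projE_tens (V : lmodType k) (v : {ffun 'I_n -> V}) :
  val (schur_proj c (tens v)) specht_gen =
  \sum_g \sum_s sym_coef g s *: tens (tuple_act (s * g)%g v).
Proof.
rewrite schur_projE /schur_proj_fun scaler_sumr; apply: eq_bigr => g _.
rewrite scaler_sumr; apply: eq_bigr => s _.
rewrite scalerA tpow_act_tens /specht_gen vsprojK //.
by apply: memv_span; apply: image_f.
Qed.

Lemma mform_schur_form (V : lmodType k) (m : {ffun 'I_n -> V} -> k^o)
    (mP : multilinear idfun m) :
  mform (schur_form mP) =1 symmetrize m.
Proof.
move=> v.
change (tpow_lift idfun m (val (schur_proj c (tens v)) specht_gen) = symmetrize m v).
rewrite schur_projE_tens.
rewrite /symmetrize pair_big /= pair_big /= (tpow_lift_sum mP).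
by apply: eq_bigr => -[g s] _ /=; rewrite tpow_lift_tens.
Qed.

Lemma schur_form_mform (V : lmodType k) (w : {scalar schur lam V}) :
  schur_form (mform_multilinear w) =1 w.
Proof.
move=> p; rewrite schur_formE -[in RHS](schur_projK cP G0 p).
elim/tens_ind: (val p specht_gen) => [|v|a x y Ex Ey].
- by rewrite (semilinear0 (tpow_lift_semilinear (mform_multilinear w))) !linear0.
- by rewrite tpow_lift_tens //; apply: mform_multilinear.
- by rewrite (tpow_lift_semilinear (mform_multilinear w)) Ex Ey !linearP.
Qed.

Lemma symmetrize_mform (V : lmodType k) (w : {scalar schur lam V}) :
  symmetrize (mform w) =1 mform w.
Proof.
move=> v; rewrite -(mform_schur_form (mform_multilinear w)).
exact: schur_form_mform.
Qed.

End MForm.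

End SchurForms.

(** * Extensible spaces *)

Section Inspan.
Variables (k : fieldType) (U : lmodType k).
Implicit Types (s t : seq U) (p q : U).

(** Coefficients are peeled off one at a time, which suits extension by one vector. Applied to lists
    of pairs, this gives graphs of linear relations. *)
Fixpoint inspan s p : Prop :=
  if s is q :: s' then exists a, inspan s' (p - a *: q) else p = 0.

Lemma inspan_lin s a p q : inspan s p -> inspan s q -> inspan s (a *: p + q).
Proof.
elim: s p q => [|x s IHs] p q /=; first by move=> -> ->; rewrite scaler0 addr0.
move=> [b pb] [d qd]; exists (a * b + d).
suff -> : a *: p + q - (a * b + d) *: x = a *: (p - b *: x) + (q - d *: x) by apply: IHs.
by rewrite scalerBr scalerA scalerDl opprD addrACA.
Qed.

Lemma inspan0 s : inspan s 0.
Proof. by elim: s => //= x s IHs; exists 0; rewrite scale0r subr0. Qed.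

Lemma inspan_cons s q p : inspan s p -> inspan (q :: s) p.
Proof. by exists 0; rewrite scale0r subr0. Qed.

Lemma inspan_head s q : inspan (q :: s) q.
Proof. by exists 1; rewrite scale1r subrr; apply: inspan0. Qed.

Lemma inspan_mem s p : p \in s -> inspan s p.
Proof.
elim: s => // q s IHs; rewrite inE => /orP[/eqP ->|/IHs]; first exact: inspan_head.
exact: inspan_cons.
Qed.

Lemma inspan_ind s (P : U -> Prop) : P 0 ->
  (forall a q p, q \in s -> P p -> P (a *: q + p)) -> forall p, inspan s p -> P p.
Proof.
elim: s => [|x s IHs] P0 PD p /=; first by move->.
move=> [a /IHs Ps]; rewrite -(subrK (a *: x) p) addrC; apply: (PD); first exact: mem_head.
by apply: Ps => // b q r qs; apply: (PD); rewrite inE qs orbT.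
Qed.

Lemma inspan_sub s t : {in s, forall p, inspan t p} -> forall p, inspan s p -> inspan t p.
Proof.
move=> st p; elim/inspan_ind => [|a q {}p qs tp]; first exact: inspan0.
by apply: inspan_lin => //; apply: st.
Qed.

Lemma inspan_sum (I : Type) (r : seq I) (P : pred I) (a : I -> k) (x : I -> U) s :
  (forall i, P i -> inspan s (x i)) -> inspan s (\sum_(i <- r | P i) a i *: x i).
Proof.
move=> sx; elim/big_rec: _ => [|i y Pi sy]; first exact: inspan0.
by apply: inspan_lin => //; apply: sx.
Qed.

Lemma inspanE s p : inspan s p -> exists c : 'I_(size s) -> k, p = \sum_i c i *: s`_i.
Proof.
elim: s p => [|x s IHs] p /=; first by move->; exists (fun=> 0); rewrite big_ord0.
move=> [a /IHs[c E]]; exists (fun i => oapp c a (unlift ord0 i)).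
rewrite big_ord_recl unlift_none /= addrC; under eq_bigr do rewrite liftK /=.
by rewrite -E subrK.
Qed.

Definition span_of s : {pred U} := fun p => `[< inspan s p >].

Lemma span_of_closed s : subsemimod_closed (span_of s).
Proof.
split; [split|].
- exact/asboolP/inspan0.
- move=> x y /asboolP sx /asboolP sy; apply/asboolP.
  by rewrite -[x]scale1r; apply: inspan_lin.
- move=> a x /asboolP sx; apply/asboolP.
  by rewrite -[_ *: _]addr0; apply/inspan_lin/inspan0.
Qed.

HB.instance Definition _ s := GRing.isSubmodClosed.Build k U (span_of s) (span_of_closed s).

Lemma finite_dim_span_of s : finite_dim (subspace (span_of s)).
Proof.
have ss i : s`_i \in span_of s.
  have [lt|ge] := ltnP i (size s); first exact/asboolP/inspan_mem/mem_nth.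
  by rewrite nth_default //; apply/asboolP/inspan0.
exists (size s), (fun i => Subspace (ss i)) => v.
have /asboolP/inspanE[c Ec] := valP v; exists c; apply/val_inj.
by rewrite [LHS]Ec linear_sum; apply: eq_bigr => i _; rewrite linearZ.
Qed.

End Inspan.

Lemma finite_dim_inspan (k : fieldType) (U : lmodType k) :
  finite_dim U -> exists s : seq U, forall p, inspan s p.
Proof.
move=> [n [e eP]]; exists (codom e) => p; have [c ->] := eP p.
by apply: inspan_sum => i _; apply/inspan_mem/codom_f.
Qed.

Section InspanMap.
Variables (k : fieldType) (U U' : lmodType k) (f : U -> U').
Hypothesis fL : linear f.

Let f0 : f 0 = 0.
Proof. exact: (semilinear0 (h := idfun)). Qed.

Lemma inspan_map s p : inspan s p -> inspan (map f s) (f p).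
Proof.
elim/inspan_ind => [|a q {}p qs IH]; first by rewrite f0; apply: inspan0.
by rewrite fL; apply: inspan_lin => //; apply/inspan_mem/map_f.
Qed.

Lemma inspan_mapE s p' : inspan (map f s) p' -> exists2 p, inspan s p & p' = f p.
Proof.
elim/inspan_ind => [|a _ x /mapP[q qs ->] [p sp ->]]; first by exists 0; [exact: inspan0|].
by exists (a *: q + p); rewrite ?fL //; apply: inspan_lin => //; apply: inspan_mem.
Qed.

End InspanMap.

(** * Multilinear maps on spans *)

Section Multilinear.
Variables (k : fieldType) (n : nat).

Lemma multilinear_upd0 (k' : fieldType) (h : {rmorphism k -> k'}) (U : lmodType k)
    (M : lmodType k') (m : {ffun 'I_n -> U} -> M) :
  multilinear h m -> forall v i, m (upd v i 0) = 0.
Proof.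
move=> mP v i; have := mP v i (-1) 0 0.
by rewrite rmorphN1 !scaleN1r !addNr.
Qed.

Lemma upd_id (T : Type) (v : {ffun 'I_n -> T}) i : upd v i (v i) = v.
Proof. by apply/ffunP=> j; rewrite ffunE; case: eqP => [->|]. Qed.

Lemma multilinear_span (U M : lmodType k) (m : {ffun 'I_n -> U} -> M) (s : seq U) :
  multilinear idfun m -> (forall v : {ffun 'I_n -> U}, (forall a, v a \in s) -> m v = 0) ->
  forall v : {ffun 'I_n -> U}, (forall a, inspan s (v a)) -> m v = 0.
Proof.
move=> mP m0 v sv.
(* Induction on the number [t] of leading arguments that may lie in the span; the later ones are
   still members of [s]. *)
suff H t : (t <= n)%N -> forall v : {ffun 'I_n -> U},
    (forall a : 'I_n, (a < t)%N -> inspan s (v a)) ->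
    (forall a : 'I_n, (t <= a)%N -> v a \in s) -> m v = 0.
  by apply: (H n) => // a; rewrite leqNgt ltn_ord.
elim: t => [|t IHt] lt {}v {}sv vs; first by apply: m0 => a; apply: vs.
rewrite -(upd_id v (Ordinal lt)).
elim/inspan_ind: (sv (Ordinal lt) (leqnn _)) => [|a q p qs IH].
  exact: multilinear_upd0.
rewrite mP IH addr0 IHt ?scaler0 ?(ltnW lt) // => b; rewrite ffunE.
  by case: eqP => [->|_ lb]; [rewrite ltnn|apply: sv; apply: ltnW].
rewrite leq_eqVlt => /orP[/eqP E|lb]; first by rewrite ifT //; apply/eqP/val_inj.
by case: eqP => // _; apply: vs.
Qed.

Lemma multilinear_comp (U V M : lmodType k) (m : {ffun 'I_n -> V} -> M) (f : U -> V) :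
  linear f -> multilinear idfun m ->
  multilinear idfun (fun v : {ffun 'I_n -> U} => m [ffun a => f (v a)]).
Proof.
move=> fL mP v i a x y.
have E z : [ffun b => f (upd v i z b)] = upd [ffun b => f (v b)] i (f z).
  by apply/ffunP=> b; rewrite !ffunE; case: ifP.
by rewrite !E fL mP.
Qed.

Lemma multilinear_lin (U M : lmodType k) (b : k) (m m' : {ffun 'I_n -> U} -> M) :
  multilinear idfun m -> multilinear idfun m' ->
  multilinear idfun (fun v : {ffun 'I_n -> U} => b *: m v + m' v).
Proof.
move=> mP mP' v i a x y; rewrite mP mP' /= !scalerDr !scalerA [b * a]mulrC.
by rewrite addrACA.
Qed.

(** The difference of the two maps is multilinear on [A * B], so [multilinear_span] applies. A list
    of pairs keeps corresponding arguments of [m] and [m'] together. *)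
Lemma multilinear_span_eq (A B M : lmodType k) (m : {ffun 'I_n -> A} -> M)
    (m' : {ffun 'I_n -> B} -> M) (s : seq (A * B)) :
  multilinear idfun m -> multilinear idfun m' ->
  (forall v : {ffun 'I_n -> A * B}, (forall a, v a \in s) ->
     m [ffun a => (v a).1] = m' [ffun a => (v a).2]) ->
  forall v : {ffun 'I_n -> A * B}, (forall a, inspan s (v a)) ->
     m [ffun a => (v a).1] = m' [ffun a => (v a).2].
Proof.
move=> mP mP' E v sv; apply/esym/eqP; rewrite -subr_eq0 addrC -scaleN1r; apply/eqP.
pose d (v : {ffun 'I_n -> A * B}) := -1 *: m [ffun a => (v a).1] + m' [ffun a => (v a).2].
apply: (multilinear_span (m := d) (s := s)) => // [|{sv}v /E Ev].
  by apply: multilinear_lin; apply: multilinear_comp.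
by rewrite /d Ev scaleN1r addNr.
Qed.

End Multilinear.

(** By linearity of the relation, single-valuedness need only be known over 0; choice then gives the
    function. *)
Lemma linear_of_graph (k : fieldType) (A B : lmodType k) (G : A -> B -> Prop) :
  (forall x, exists y, G x y) -> (forall y, G 0 y -> y = 0) ->
  (forall a x y x' y', G x y -> G x' y' -> G (a *: x + x') (a *: y + y')) ->
  exists f : {linear A -> B}, forall x y, G x y <-> y = f x.
Proof.
move=> tot func lin.
have uniq x y y' : G x y -> G x y' -> y = y'.
  move=> Gy Gy'; apply/esym/eqP; rewrite -subr_eq0 addrC; apply/eqP/func.
  by have := lin (-1) _ _ _ _ Gy Gy'; rewrite !scaleN1r addNr.
have [f fG] := choice tot.
have fL : linear f by move=> a x y; apply: uniq (fG _) _; apply: lin.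
pose fM := GRing.isLinear.Build k A B _ f fL.
pose F : {linear A -> B} := HB.pack f fM.
by exists F => x y; split=> [Gy|->]; [apply: uniq Gy (fG x) | apply: fG].
Qed.

(** * Partial isometries, extensibility and back-and-forth *)

Section Extension.
Variables (k : fieldType) (r : nat) (lam : r.-tuple intpart).
Local Notation n i := (sumn (tnth lam i)).
Variable c : forall i, {perm 'I_(n i)} -> tabloid (tnth lam i) -> k.
Arguments c : clear implicits.
Hypotheses (cP : forall i, splits (c i))
  (G0 : forall i, #|{perm 'I_(n i)}|%:R != 0 :> k) (n_gt0 : forall i, (0 < n i)%N).
Arguments cP : clear implicits.
Implicit Types V W : lspace k lam.

Definition mf V i (v : {ffun 'I_(n i) -> V}) : k^o := mform (c i) (omega V i) v.

Lemma mf_multilinear V i : multilinear idfun (@mf V i).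
Proof. exact: mform_multilinear. Qed.

Lemma embeddingP V W (f : {linear W -> V}) : embedding f <->
  injective f /\ forall i (v : {ffun 'I_(n i) -> W}), mf [ffun a => f (v a)] = mf v.
Proof.
split=> -[fI fE]; split=> // i; have H := mform_map (cP i) (G0 i) f (omega V i) (omega W i).
  by apply/H => x; apply: fE.
by move=> x; apply: (proj2 H); apply: fE.
Qed.

(* The span of s is the graph of an isomorphism between subspaces of V and W. *)
Definition partial_iso V W (s : seq (V * W)) := forall p, inspan s p -> p.1 = 0 <-> p.2 = 0.
Definition partial_isometry V W (s : seq (V * W)) := partial_iso s /\
  forall i (v : {ffun 'I_(n i) -> V * W}), (forall a, inspan s (v a)) ->
    mf [ffun a => (v a).1] = mf [ffun a => (v a).2].

Definition extensible V := forall W (s : seq (W * V)) (w : W),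
  partial_isometry s -> exists v, partial_isometry ((w, v) :: s).

(** All arguments are 0 here. The forms vanish on them because each has at least one argument, which
    is where purity of the tuple enters. *)
Lemma partial_isometry_nil V W : @partial_isometry V W [::].
Proof.
split=> [p /= -> //|i v v0].
rewrite -[[ffun a => (v a).1]](upd_id _ (Ordinal (n_gt0 i))).
rewrite -[[ffun a => (v a).2]](upd_id _ (Ordinal (n_gt0 i))).
rewrite !ffunE /= (v0 _) /= (multilinear_upd0 (@mf_multilinear V i)).
by rewrite (multilinear_upd0 (@mf_multilinear W i)).
Qed.

Lemma partial_isometry_sub V W (s t : seq (V * W)) : partial_isometry t ->
  (forall p, inspan s p -> inspan t p) -> partial_isometry s.
Proof.
move=> [t0 tE] st; split=> [p /st/t0 //|i v sv].
by apply: tE => a; apply/st/sv.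
Qed.

(** Embeddings preserve and reflect both vanishing and the forms. This moves partial isometries
    between a space and its subspaces, and along isomorphisms. *)
Lemma partial_isometry_map V V' W W' (f : {linear V -> V'}) (g : {linear W -> W'}) s :
  embedding f -> embedding g ->
  partial_isometry [seq (f p.1, g p.2) | p <- s] <-> partial_isometry s.
Proof.
move=> /embeddingP[fI fE] /embeddingP[gI gE].
have f0 x : f x = 0 <-> x = 0 by split=> [|->]; rewrite ?linear0 // -(linear0 f) => /fI.
have g0 x : g x = 0 <-> x = 0 by split=> [|->]; rewrite ?linear0 // -(linear0 g) => /gI.
have fgL : linear (fun p : V * W => (f p.1, g p.2)).
  by move=> a x y /=; rewrite !linearP.
split=> -[s0 sE]; split.
- by move=> p /(inspan_map fgL)/s0 /=; rewrite f0 g0.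
- move=> i v sv; pose v' := [ffun a => (f (v a).1, g (v a).2)].
  have /sE : forall a, inspan [seq (f p.1, g p.2) | p <- s] (v' a).
    by move=> a; rewrite ffunE; apply: (inspan_map fgL).
  rewrite -fE -gE => E; refine (etrans (congr1 _ _) (etrans E (congr1 _ _)));
  by apply/ffunP=> a; rewrite !ffunE.
- by move=> p /(inspan_mapE fgL)[q /s0 sq ->] /=; rewrite f0 g0.
- move=> i v sv; have /choice[u uP] : forall a, exists q, inspan s q /\ v a = (f q.1, g q.2).
    by move=> a; have [q] := inspan_mapE fgL (sv a); exists q.
  have /sE : forall a, inspan s ([ffun a => u a] a).
    by move=> a; rewrite ffunE; have [] := uP a.
  rewrite -fE -gE => E.
  refine (etrans (congr1 _ _) (etrans E (congr1 _ _)));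
  by apply/ffunP=> a; rewrite !ffunE; have [_ ->] := uP a.
Qed.

Lemma partial_isometry_swap V W (s : seq (V * W)) :
  partial_isometry s -> partial_isometry [seq (p.2, p.1) | p <- s].
Proof.
have sL : linear (fun p : V * W => (p.2, p.1)) by [].
move=> [s0 sE]; split=> [p /(inspan_mapE sL)[q /s0 sq ->]|i v sv].
  by rewrite /= sq.
have := sE i [ffun a => ((v a).2, (v a).1)].
have vE a : inspan s ([ffun a => ((v a).2, (v a).1)] a).
  by rewrite ffunE; have [q sq ->] := inspan_mapE sL (sv a); case: q sq.
move=> /(_ vE) E; refine (etrans (congr1 _ _) (etrans (esym E) (congr1 _ _)));
by apply/ffunP=> a; rewrite !ffunE.
Qed.

Lemma partial_isometry_embedding V W (f : {linear V -> W}) s : embedding f ->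
  (forall p, p \in s -> p.2 = f p.1) -> partial_isometry s.
Proof.
move=> /embeddingP[fI fE] sf.
have {}sf p : inspan s p -> p.2 = f p.1.
  elim/inspan_ind=> [|a q {}p /sf Eq Ep]; first exact/esym/linear0.
  by rewrite /= linearP -Eq -Ep.
split=> [p /sf ->|i v sv].
  by split=> [->|E]; [rewrite linear0|apply: fI; rewrite E linear0].
by rewrite -fE; congr mf; apply/ffunP=> a; rewrite !ffunE (sf _ (sv a)).
Qed.

Section Graph.
Variables (V W : lspace k lam) (G : V -> W -> Prop).
Hypotheses (Gtot : forall x, exists y, G x y)
  (G0' : forall x y, G x y -> x = 0 <-> y = 0)
  (Glin : forall a x y x' y', G x y -> G x' y' -> G (a *: x + x') (a *: y + y'))
  (GE : forall i (v : {ffun 'I_(n i) -> V * W}), (forall a, G (v a).1 (v a).2) ->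
    mf [ffun a => (v a).1] = mf [ffun a => (v a).2]).

Lemma embedding_of_graph :
  exists f : {linear V -> W}, embedding f /\ forall x y, G x y <-> y = f x.
Proof.
have [|f fG] := linear_of_graph Gtot _ Glin; first by move=> y /G0' <-.
have Gf x : G x (f x) by apply/fG.
exists f; split=> //; apply/embeddingP; split=> [x y E|i v].
  apply/eqP; rewrite -subr_eq0 addrC -scaleN1r; apply/eqP.
  apply: (proj2 (G0' (Gf _))); rewrite linearP E.
  by rewrite scaleN1r addNr.
have /GE : forall a, G ([ffun a => (v a, f (v a))] a).1 ([ffun a => (v a, f (v a))] a).2.
  by move=> a; rewrite ffunE; apply: Gf.
move=> E; refine (etrans (congr1 _ _) (etrans (esym E) (congr1 _ _)));
by apply/ffunP=> a; rewrite !ffunE.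
Qed.

Hypothesis Gsurj : forall y, exists x, G x y.

Lemma isomorphism_of_graph :
  exists f : {linear V -> W}, isomorphism f /\ forall x y, G x y <-> y = f x.
Proof.
have [f [fE fG]] := embedding_of_graph; exists f; split=> //; split=> //.
have [g gP] := choice Gsurj.
exists g => [x|y]; last by apply/esym/fG.
by apply: fE.1; apply/esym/fG.
Qed.

End Graph.

(** The vector [w] and the domain of [s] span a finite-dimensional space [W1]. Universality embeds
    [W1] into [V] by [f]; then [s] becomes an isometry between two subspaces of [V], and homogeneity
    extends it to an automorphism [h]. The required vector is [h (f w)]. *)
Lemma universal_homogeneous_extensible V :
  universal V -> homogeneous V -> extensible V.
Proof.
move=> Vu Vh W s w sP.
pose t := w :: map fst s; pose W1 := @induced _ _ lam W (span_of t).
have lift x : inspan t x -> exists x1 : W1, val x1 = x.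
  by move=> tx; have tx' : x \in span_of t by [apply/asboolP]; exists (Subspace tx').
have [w1 w1E] : exists w1 : W1, val w1 = w by apply/lift/inspan_head.
have [s1 s1E] : exists s1 : seq (W1 * V), [seq (val p.1, p.2) | p <- s1] = s.
  have : forall p, p \in s -> inspan t p.1.
    by move=> p ps; apply/inspan_cons/inspan_mem/map_f.
  elim: (s) => [|p u IHu] ut; first by exists [::].
  have [|u1 <-] := IHu; first by move=> q qu; apply: ut; rewrite inE qu orbT.
  have [x1 E] := lift _ (ut _ (mem_head _ _)).
  by exists ((x1, p.2) :: u1) => /=; rewrite E -surjective_pairing.
have valE : embedding (val : {linear W1 -> W}) by split=> //; apply: val_inj.
have idE : embedding (idfun : {linear V -> V}).
  by apply/embeddingP; split=> // i v; congr mf; apply/ffunP=> a; rewrite ffunE.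
have {}sP : partial_isometry s1 by apply/(partial_isometry_map s1 valE idE); rewrite s1E.
have [f fE] := Vu W1 (finite_dim_span_of _).
pose s2 := [seq (f p.1, p.2) | p <- s1].
have s2P : partial_isometry s2 by apply/(partial_isometry_map s1 fE idE).
pose A := span_of (map fst s2); pose B := span_of (map snd s2).
(* The span of [s2], seen as the graph of an isomorphism from [A] to [B]. *)
pose G (x : @induced _ _ lam V A) (y : @induced _ _ lam V B) := inspan s2 (val x, val y).
have [|||||g [gE gG]] := @isomorphism_of_graph (@induced _ _ lam V A) (@induced _ _ lam V B) G.
- move=> x; have /asboolP/inspan_mapE[//|[a b] ab E] := valP x.
  have sb : b \in B by apply/asboolP; apply: (inspan_map (f := snd) _ ab).
  by exists (Subspace sb); rewrite /G E.
- move=> x y /s2P.1 /= H; split=> [x0|y0]; apply/val_inj; apply/H.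
    by rewrite x0.
  by rewrite y0.
- by move=> a x y x' y' Gx Gx'; have := inspan_lin a Gx Gx'; rewrite /G !linearP.
- move=> i v vG.
  have valA (C : submodClosed V) (u : {ffun 'I_(n i) -> @induced _ _ lam V C}) :
      mf [ffun a => val (u a)] = mf u.
    have vE : embedding (val : {linear @induced _ _ lam V C -> V}) by split=> //; apply: val_inj.
    by have [_ ->] := proj1 (embeddingP _) vE.
  rewrite -!valA.
  have /s2P.2 E : forall a, inspan s2 ([ffun a => (val (v a).1, val (v a).2)] a).
    by move=> a; rewrite ffunE; apply: vG.
  refine (etrans (congr1 _ _) (etrans E (congr1 _ _))); by apply/ffunP=> a; rewrite !ffunE.
- move=> y; have /asboolP/inspan_mapE[//|[a b] ab E] := valP y.
  have sa : a \in A by apply/asboolP; apply: (inspan_map (f := fst) _ ab).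
  by exists (Subspace sa); rewrite /G E.
have [h [[_ hE] hg]] := Vh A B (finite_dim_span_of _) (finite_dim_span_of _) g gE.
exists (h (f w1)); rewrite -w1E -s1E.
rewrite -[_ :: _]/[seq (val p.1, p.2) | p <- (w1, h (f w1)) :: s1].
apply/(partial_isometry_map _ valE idE).
(* The map [h \o f] embeds [W1] and agrees with [s1], so the extended list is part of its graph. *)
have hfE : embedding (h \o f : {linear W1 -> V}).
  move/embeddingP: hE => [hI hE]; move/embeddingP: fE => [fI fE].
  apply/embeddingP; split=> [|i v]; first exact: inj_comp.
  by rewrite -fE -[RHS]hE; congr mf; apply/ffunP=> a; rewrite !ffunE.
apply: (partial_isometry_embedding hfE) => p; rewrite inE => /orP[/eqP -> //|ps1].
have ps2 : (f p.1, p.2) \in s2 by apply: map_f.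
have sa : f p.1 \in A by apply/asboolP/inspan_mem/(map_f fst ps2).
have sb : p.2 \in B by apply/asboolP/inspan_mem/(map_f snd ps2).
have := hg (Subspace sa); rewrite /= => ->.
have : G (Subspace sa) (Subspace sb) by apply: inspan_mem.
by move/gG <-.
Qed.

(** Starting from the empty isometry, extend along a spanning list of [W]; the span of the resulting
    list is the graph of an embedding. *)
Lemma extensible_universal V : extensible V -> universal V.
Proof.
move=> Ve W /finite_dim_inspan[t tW].
have [s [sP sE]] : exists s : seq (W * V), partial_isometry s /\ map fst s = t.
  elim: (t) => [|w u [s [sP <-]]]; first by exists [::]; split=> //; apply: partial_isometry_nil.
  by have [v vP] := Ve _ _ w sP; exists ((w, v) :: s).
have [||||f [fE _]] := @embedding_of_graph W V (fun x y => inspan s (x, y)); last by exists f.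
- move=> x; have := tW x; rewrite -sE => /inspan_mapE[//|[a b] ab ->].
  by exists b.
- by move=> x y /sP.1.
- by move=> a x y x' y' sx /(inspan_lin a sx).
- by move=> i v sv; apply: sP.2 => a; have := sv a; case: (v a).
Qed.

Definition countably_spanned V := exists e : nat -> V, forall v, exists m, inspan (mkseq e m) v.

Lemma back_and_forth V V' (s0 : seq (V * V')) :
  extensible V -> extensible V' -> countably_spanned V -> countably_spanned V' ->
  partial_isometry s0 ->
  exists f : {linear V -> V'}, isomorphism f /\ forall p, inspan s0 p -> p.2 = f p.1.
Proof.
move=> Ve Ve' [e eP] [e' eP'] s0P.
(* One step adds [e m] to the domain and [e' m] to the range. The isometry hypothesis sits under the
   existential so that choice yields a function of all pairs [(m, s)]. *)
have step m s : exists s' : seq (V * V'), partial_isometry s ->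
    [/\ partial_isometry s', forall p, inspan s p -> inspan s' p,
        exists y, inspan s' (e m, y) & exists x, inspan s' (x, e' m)].
  have [sP|nP] := pselect (partial_isometry s); last by exists s.
  have [y yP] := Ve' _ _ (e m) sP.
  have [x xP] := Ve _ _ (e' m) (partial_isometry_swap yP).
  exists [:: (x, e' m), (e m, y) & s] => _; split.
  - have := partial_isometry_swap xP; rewrite /= -map_comp.
    by rewrite (eq_map (_ : _ =1 id)) ?map_id => [|[]].
  - by move=> p sp; do 2!apply: inspan_cons.
  - by exists y; apply/inspan_cons/inspan_head.
  - by exists x; apply/inspan_head.
have [F FP] := choice (fun ms : nat * seq (V * V') => step ms.1 ms.2).
pose S := fix S m := if m is m'.+1 then F (m', S m') else s0.
have SP m : partial_isometry (S m).
  by elim: m => // m IHm; have [] := FP (m, S m) IHm.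
have Smono m l p : (m <= l)%N -> inspan (S m) p -> inspan (S l) p.
  elim: l => [|l IHl]; first by rewrite leqn0 => /eqP ->.
  rewrite leq_eqVlt => /orP[/eqP -> //|ml] /(IHl ml).
  by have [_ + _ _] := FP (l, S l) (SP l); apply.
(* The union of the increasing chain of spans. Finitely many arguments lie in a common stage, so [G]
   inherits the isometry property from the stages. *)
pose G x y := exists m, inspan (S m) (x, y).
have Gmem i (v : {ffun 'I_(n i) -> V * V'}) : (forall a, G (v a).1 (v a).2) ->
    exists m, forall a, inspan (S m) (v a).
  move=> vG; have /choice[M MP] : forall a, exists m, inspan (S m) (v a).
    by move=> a; have [m] := vG a; exists m; rewrite [v a]surjective_pairing.
  exists (\max_a M a)%N => a; apply: Smono (MP a); exact: leq_bigmax.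
have Glin a x y x' y' : G x y -> G x' y' -> G (a *: x + x') (a *: y + y').
  move=> [m Gx] [l Gx']; exists (maxn m l).
  by apply: (inspan_lin a (Smono _ _ _ (leq_maxl m l) Gx) (Smono _ _ _ (leq_maxr m l) Gx')).
have G00 : G 0 0 by exists 0%N; apply: inspan0.
have [|||||f [fE fG]] := @isomorphism_of_graph V V' G.
- move=> x; have [m] := eP x; elim/inspan_ind=> [|a q p /mapP[j _ ->] [y Gp]].
    by exists 0.
  have [_ _ [z zP] _] := FP (j, S j) (SP j).
  by exists (a *: z + y); apply: Glin => //; exists j.+1.
- by move=> x y [m /(SP m).1].
- exact: Glin.
- by move=> i v /Gmem[m] /(SP m).2.
- move=> x; have [m] := eP' x; elim/inspan_ind=> [|a q p /mapP[j _ ->] [y Gp]].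
    by exists 0.
  have [_ _ _ [z zP]] := FP (j, S j) (SP j).
  by exists (a *: z + y); apply: Glin => //; exists j.+1.
exists f; split=> // -[x y] sp; apply/fG; by exists 0%N.
Qed.

Lemma extensible_isomorphic V V' : extensible V -> extensible V' ->
  countably_spanned V -> countably_spanned V' -> exists f : {linear V -> V'}, isomorphism f.
Proof.
move=> Ve Ve' Vc Vc'.
have [f [fE _]] := back_and_forth Ve Ve' Vc Vc' (@partial_isometry_nil V V').
by exists f.
Qed.

(** An isomorphism between finite-dimensional subspaces is recorded by its values on a spanning
    list; this list is a partial isometry from [V] to itself, at which the back-and-forth starts. *)
Lemma extensible_homogeneous V : extensible V -> countably_spanned V -> homogeneous V.
Proof.
move=> Ve Vc A B fA fB g [_ gE]; have [t tA] := finite_dim_inspan fA.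
pose s := [seq (x, g x) | x <- t].
have valE (C : submodClosed V) : embedding (val : {linear @induced _ _ lam V C -> V}).
  by split=> //; apply: val_inj.
have sP : partial_isometry [seq (val p.1, val p.2) | p <- s].
  apply/(partial_isometry_map s (valE A) (valE B)).
  by apply: (partial_isometry_embedding gE) => _ /mapP[x _ ->].
have [h [hE hs]] := back_and_forth Ve Ve Vc Vc sP.
exists h; split=> // w; apply/esym.
apply: (hs (val w, val (g w))); rewrite -map_comp.
apply: (inspan_map (f := fun x => (val x, val (g x)))) (tA w).
by move=> a x y; rewrite !linearP.
Qed.

Lemma extensible_iso V V' (f : {linear V -> V'}) : isomorphism f -> extensible V' -> extensible V.
Proof.
move=> [[g fK gK] fE] Ve W s w sP.
have idE : embedding (idfun : {linear W -> W}).
  by apply/embeddingP; split=> // i v; congr mf; apply/ffunP=> a; rewrite ffunE.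
have [v vP] := Ve W [seq (p.1, f p.2) | p <- s] w (proj2 (partial_isometry_map s idE fE) sP).
exists (g v); apply/(partial_isometry_map _ idE fE); rewrite /= gK; exact: vP.
Qed.

Lemma countably_spanned_iso V V' (f : {linear V -> V'}) :
  bijective f -> countably_spanned V' -> countably_spanned V.
Proof.
move=> [g fK gK] [e eP]; exists (g \o e) => v; have [m] := eP (f v); exists m.
have gL : linear g by move=> a x y; apply: (can_inj fK); rewrite linearP !gK.
by rewrite /mkseq map_comp -(fK v); apply: inspan_map.
Qed.

Lemma countable_dim_spanned V : countable_dim V -> countably_spanned V.
Proof.
move=> [e [eP _]]; exists e => v; have [m [a ->]] := eP v; exists m.
apply: (inspan_sum _ (fun i : 'I_m => a i)) => i _.
by apply/inspan_mem/map_f; rewrite mem_iota ltn_ord.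
Qed.

End Extension.

(** * The model *)

Section PolyForm.
Variables (k : fieldType) (n : nat).
Implicit Type d : {ffun 'I_n -> nat} -> k.
Implicit Type v : {ffun 'I_n -> {poly k}}.

(** The extra index [S] keeps the index type inhabited, as [inord] requires; tuples containing it
    contribute nothing once all sizes are at most [S]. *)
Definition polyform_upto d S v : k^o :=
  \sum_(g : {ffun 'I_n -> 'I_S.+1}) (\prod_a (v a)`_(g a)) * d [ffun a => nat_of_ord (g a)].

(* The n-linear form on {poly k} with value d j at the monomials 'X^(j a). *)
Definition polyform d v : k^o := polyform_upto d (\max_a size (v a))%N v.

Lemma polyform_upto_multilinear d S : multilinear idfun (polyform_upto d S).
Proof.
move=> v i a x y; rewrite /polyform_upto scaler_sumr -big_split /=; apply: eq_bigr => g _.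
have E z : \prod_j (upd v i z j)`_(g j) = z`_(g i) * \prod_(j | j != i) (v j)`_(g j).
  rewrite (bigD1 i) //= ffunE eqxx; congr (_ * _).
  by apply: eq_bigr => j /negPf ji; rewrite ffunE ji.
by rewrite !E coefD coefZ -!mulrA mulrDl -mulrA.
Qed.

Lemma polyform_upto_widen d S S' v : (S <= S')%N -> (forall a, (size (v a) <= S)%N) ->
  polyform_upto d S v = polyform_upto d S' v.
Proof.
move=> le vS; rewrite /polyform_upto.
(* Index tuples with an entry above [S] meet a zero coefficient; the others are reindexed through
   [inord]. *)
rewrite [RHS](bigID (fun g : {ffun 'I_n -> 'I_S'.+1} => [forall a, (g a < S.+1)%N])) /=.
rewrite [X in _ = _ + X]big1 ?addr0 => [|g]; last first.
  rewrite negb_forall => /existsP[a]; rewrite -leqNgt => Sa.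
  by rewrite (bigD1 a) //= nth_default ?mul0r // (leq_trans (vS a)) // ltnW.
rewrite [RHS](reindex_onto (fun g : {ffun 'I_n -> 'I_S.+1} => [ffun a => inord (g a)])
  (fun g => [ffun a => inord (g a)])) /= => [|g /forallP gS]; last first.
  by apply/ffunP=> a; rewrite !ffunE (inordK (gS a)) inord_val.
have inS (g : {ffun 'I_n -> 'I_S.+1}) a : nat_of_ord (inord (g a) : 'I_S'.+1) = g a.
  by rewrite inordK // (leq_trans (ltn_ord _)).
apply: eq_big => [g|g _].
  apply/esym/andP; split; first by apply/forallP=> a; rewrite ffunE inS.
  by apply/eqP/ffunP=> a; apply/val_inj; rewrite !ffunE inS inord_val.
congr (_ * d _); last by apply/ffunP=> a; rewrite !ffunE inS.
by apply: eq_bigr => a _; rewrite ffunE inS.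
Qed.

Lemma polyformE d S v : (forall a, (size (v a) <= S)%N) -> polyform d v = polyform_upto d S v.
Proof.
move=> vS; apply: polyform_upto_widen; first exact/bigmax_leqP.
by move=> a; apply: (leq_bigmax a).
Qed.

Lemma polyform_multilinear d : multilinear idfun (polyform d).
Proof.
move=> v i a x y.
pose S := (maxn (\max_a size (v a)) (maxn (size x) (size y)))%N.
have uS (z : {poly k}) : (size z <= S)%N -> forall b, (size (upd v i z b) <= S)%N.
  move=> zS b; rewrite ffunE; case: ifP => // _; rewrite leq_max; apply/orP; left.
  exact: (leq_bigmax b).
have xS : (size x <= S)%N by rewrite !leq_max leqnn !orbT.
have yS : (size y <= S)%N by rewrite !leq_max leqnn !orbT.
rewrite !(@polyformE _ S) ?polyform_upto_multilinear //; apply: uS => //.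
apply: leq_trans (size_polyD _ _) _; rewrite geq_max yS andbT.
exact: leq_trans (size_scale_leq _ _) xS.
Qed.

(** For evaluating the model form at a fresh vector, where freshness of the monomials leaves a
    single term. *)
Lemma polyform1 d v (g0 : {ffun 'I_n -> nat}) :
  (forall g : {ffun 'I_n -> nat}, (forall a, (v a)`_(g a) != 0) -> d g != 0 -> g = g0) ->
  polyform d v = (\prod_a (v a)`_(g0 a)) * d g0.
Proof.
move=> v1; pose S := (maxn (\max_a size (v a)) (\max_a g0 a))%N.
have vS a : (size (v a) <= S)%N by rewrite leq_max; apply/orP; left; apply: (leq_bigmax a).
have gS a : (g0 a < S.+1)%N by rewrite ltnS leq_max; apply/orP; right; apply: (leq_bigmax a).
rewrite (polyformE d vS) /polyform_upto (bigD1 [ffun a => Ordinal (gS a)]) //=.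
have -> : [ffun a => nat_of_ord ([ffun a => Ordinal (gS a)] a)] = g0.
  by apply/ffunP=> a; rewrite !ffunE.
rewrite [X in _ + X]big1 ?addr0 => [|g /negP ne].
  by congr (_ * _); apply: eq_bigr => a _; rewrite ffunE.
apply/eqP; apply/negPn/negP => nz; apply: ne; move: nz; rewrite mulf_eq0 negb_or.
move=> /andP[/prodf_neq0 nz dg]; apply/eqP/ffunP=> a; rewrite ffunE; apply/val_inj.
have -> : val (g a) = [ffun a => nat_of_ord (g a)] a by rewrite ffunE.
by rewrite (v1 _ _ dg) // => b; rewrite ffunE; apply: nz.
Qed.

End PolyForm.

Lemma polyform_map (k k' : fieldType) (h : {rmorphism k -> k'}) n
    (d : {ffun 'I_n -> nat} -> k) (v : {ffun 'I_n -> {poly k}}) :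
  polyform (fun j => h (d j)) [ffun a => map_poly h (v a)] = h (polyform d v).
Proof.
rewrite [in LHS](@polyformE _ _ _ (\max_a size (v a))) => [|a]; last first.
  by rewrite ffunE size_map_poly; apply: (leq_bigmax a).
rewrite [RHS]rmorph_sum; apply: eq_bigr => g _; rewrite rmorphM rmorph_prod.
by congr (_ * _); apply: eq_bigr => a _; rewrite ffunE coef_map.
Qed.

(** * Extension of linear maps from finite-dimensional subspaces of k[X] *)

Section LinearExtension.
Variables (k : fieldType).

Definition functional (A B : lmodType k) (s : seq (A * B)) :=
  forall p, inspan s p -> p.1 = 0 -> p.2 = 0.

Lemma functional_extend (A B : lmodType k) (s : seq (A * B)) (t : seq A) :
  functional s -> exists t', map fst t' = t /\ functional (t' ++ s).
Proof.
move=> sF; elim: t => [|x t [t' [<- {sF}tF]]]; first by exists [::].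
(* If [x] already lies in the domain of the span, its value is forced; otherwise any value will do,
   and 0 is taken. *)
have [[y xy]|nx] := pselect (exists y, inspan (t' ++ s) (x, y)).
  exists ((x, y) :: t'); split=> // p [a sp]; apply: tF.
  by rewrite -(subrK (a *: (x, y)) p) addrC; apply: inspan_lin.
exists ((x, 0) :: t'); split=> // p [a sp] p1.
have [a0|a0] := eqVneq a 0; first by apply: tF p1; rewrite a0 scale0r subr0 in sp.
(* A nonzero coefficient [a] would put [x] into the domain. *)
case: nx; exists (- a^-1 *: p.2); have := inspan_lin (- a^-1) sp (inspan0 _).
rewrite addr0; suff -> : - a^-1 *: (p - a *: (x, 0 : B)) = (x, - a^-1 *: p.2) by [].
case: p p1 {sp} => p1 p2 /= ->; congr (_, _) => /=.
  by rewrite sub0r scalerN scaleNr opprK scalerA mulVf ?scale1r.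
by rewrite scaler0 subr0.
Qed.

Lemma poly_sum_monomials N (p : {poly k}) : (size p <= N)%N ->
  p = \sum_(i < N) p`_i *: 'X^i.
Proof.
move=> pN; rewrite -poly_def; apply/polyP=> i; rewrite coef_poly.
by case: ltnP => // Ni; rewrite nth_default // (leq_trans pN).
Qed.

Lemma size_inspan (N : nat) (s : seq {poly k}) p : (forall q, q \in s -> (size q <= N)%N) ->
  inspan s p -> (size p <= N)%N.
Proof.
move=> sN; elim/inspan_ind => [|a q {}p qs pN]; first by rewrite size_poly0.
apply: leq_trans (size_polyD _ _) _; rewrite geq_max pN andbT.
exact: leq_trans (size_scale_leq _ _) (sN _ qs).
Qed.

Definition monomial_lift (B : lmodType k) N (b : nat -> B) (p : {poly k}) : B :=
  \sum_(i < N) p`_i *: b i.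

Lemma monomial_lift_linear (B : lmodType k) N (b : nat -> B) : linear (monomial_lift N b).
Proof.
move=> a p q; rewrite /monomial_lift scaler_sumr -big_split /=; apply: eq_bigr => i _.
by rewrite coefD coefZ scalerDl scalerA.
Qed.

HB.instance Definition _ (B : lmodType k) N (b : nat -> B) :=
  GRing.isLinear.Build k {poly k} B _ (monomial_lift N b) (monomial_lift_linear N b).

(** With [N] a bound on the sizes in the domain, values are also prescribed at the monomials below
    ['X^N], consistently with [s]. Reading off coefficients then defines the map on all polynomials,
    the monomials from ['X^N] on going to 0. *)
Lemma poly_linear_extension (B : lmodType k) (s : seq ({poly k} * B)) : functional s ->
  exists f : {linear {poly k} -> B}, forall p, inspan s p -> f p.1 = p.2.
Proof.
move=> sF; have [N sN] : exists N, forall p, p \in s -> (size p.1 <= N)%N.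
  elim: (s) => [|q s' [N sN]]; first by exists 0%N.
  exists (maxn (size q.1) N) => p; rewrite inE leq_max => /orP[/eqP ->|/sN ->].
    by rewrite leqnn.
  by rewrite orbT.
have [t [tE tF]] := functional_extend (mkseq (fun i => 'X^i : {poly k}) N) sF.
exists (monomial_lift N (fun i => (t`_i).2)) => p sp.
have fstL : linear (fst : {poly k} * B -> {poly k}) by [].
have pN : (size p.1 <= N)%N.
  apply: size_inspan (inspan_map fstL sp) => _ /mapP[q qs ->].
  exact: sN.
have tp : inspan (t ++ s) (p.1, monomial_lift N (fun i => (t`_i).2) p.1).
  have -> : (p.1, monomial_lift N (fun i => (t`_i).2) p.1) = \sum_(i < N) p.1`_i *: t`_i.
    rewrite [RHS]surjective_pairing; congr (_, _).
      rewrite {1}(poly_sum_monomials pN) (raddf_sum fst) /=; apply: eq_bigr => i _.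
      have <- // : (t`_i).1 = 'X^i.
      rewrite -[LHS](nth_map _ 0) ?tE ?nth_mkseq //.
      by rewrite -(size_map fst) tE size_mkseq.
    by rewrite (raddf_sum snd) /=; apply: eq_bigr.
  apply: inspan_sum => i _; apply/inspan_mem; rewrite mem_cat mem_nth //.
  by rewrite -(size_map fst) tE size_mkseq.
have sp' : inspan (t ++ s) p.
  by apply: inspan_sub sp => q qs; apply: inspan_mem; rewrite mem_cat qs orbT.
apply/eqP; rewrite -subr_eq0; apply/eqP.
have := inspan_lin (-1) sp' tp => /tF /=; rewrite !scaleN1r addNr addrC; exact.
Qed.

End LinearExtension.

(** * Fresh monomials and the model space *)

Section Model.
Variables (k : fieldType) (r : nat) (lam : r.-tuple intpart).
Local Notation n i := (sumn (tnth lam i)).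

Definition slot := {i : 'I_r & ({ffun 'I_(n i) -> nat} * 'I_(n i))%type}.

(** An injective coding of a level and a slot as an exponent. The slot [None] reserves a monomial at
    which a fresh vector has coefficient 1, for linear independence. *)
Definition key (N : nat) (t : option slot) : nat := CodeSeq.code [:: N; pickle t].

Definition unkey (l : nat) : option (nat * option slot) :=
  if CodeSeq.decode l is [:: N; q] then omap (pair N) (unpickle q) else None.

Lemma keyK N t : unkey (key N t) = Some (N, t).
Proof. by rewrite /unkey /key CodeSeq.codeK pickleK. Qed.

(** The code of a list exceeds its entries. Hence the fresh monomials of level [N] are not among the
    first [N] monomials. *)
Lemma gt_key N t : (N < key N t)%N.
Proof. by have := CodeSeq.gtn_decode (key N t); rewrite CodeSeq.codeK => /andP[]. Qed.

(* The monomials occurring in a generic one-vector extension of the span of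
   'X^0, ..., 'X^N.-1: an n-tuple f of indices has N in the places of the new
   vector, and at each of these places a fresh monomial encodes the whole of f. *)
Definition skeleton i (N : nat) (f : {ffun 'I_(n i) -> nat}) : {ffun 'I_(n i) -> nat} :=
  [ffun a => if (f a < N)%N then f a else key N (Some (Tagged _ (f, a)))].

Definition is_skeleton i (j : {ffun 'I_(n i) -> nat}) : bool :=
  `[< exists N (f : {ffun 'I_(n i) -> nat}),
    [/\ forall a, (f a <= N)%N, exists a, f a = N & j = skeleton N f] >].

Definition model_form i : {ffun 'I_(n i) -> {poly k}} -> k^o :=
  polyform (fun j => (is_skeleton j)%:R).

Definition model : lspace k lam := @LSpace k r lam {poly k}
  (fun i => schur_form (polyform_multilinear (fun j => (is_skeleton j)%:R))).

End Model.

(** * Vectors realising prescribed values *)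

Section ModelExtensible.
Variables (k : fieldType) (r : nat) (lam : r.-tuple intpart).
Local Notation n i := (sumn (tnth lam i)).

Definition monomial_or i (N : nat) (u : {poly k}) (f : {ffun 'I_(n i) -> nat}) :
  {ffun 'I_(n i) -> {poly k}} := [ffun a => if (f a < N)%N then 'X^(f a) else u].

Section Fresh.
Variables (N : nat) (tau : forall i, {ffun 'I_(n i) -> nat} -> k).

(* The coefficients of the vector realising tau: the product over the places
   where f takes the value N of the coefficients at the keys of f is tau f. *)
Definition fresh_coef (l : nat) : k :=
  if unkey lam l is Some (N', t) then
    if N' == N then
      if t is Some (existT i (f, a)) then
        if [pick b | f b == N] == Some a then tau f else 1
      else 1
    else 0
  else 0.

Lemma fresh_coef_key (t : option (slot lam)) : fresh_coef (key N t) =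
  if t is Some (existT i (f, a)) then if [pick b | f b == N] == Some a then tau f else 1 else 1.
Proof. by rewrite /fresh_coef keyK eqxx. Qed.

End Fresh.

(** Let [j] be the skeleton of [g] at level [N']. An exponent with nonzero fresh coefficient lies
    above [N], and if it is a key then its level is [N]. This yields first [N' = N], then that [g]
    and [f] take the value [N] at the same places and agree elsewhere. *)
Lemma skeleton_unique N i (tau : forall i, {ffun 'I_(n i) -> nat} -> k)
    (f : {ffun 'I_(n i) -> nat}) (j : {ffun 'I_(n i) -> nat}) :
  (forall a, f a <= N)%N -> (exists a, f a = N) -> is_skeleton j ->
  (forall a, (f a < N)%N -> j a = f a) ->
  (forall a, f a = N -> fresh_coef N tau (j a) != 0) ->
  j = skeleton N f.
Proof.
move=> fN [a0 fa0] /asboolP[N' [g [gN [a1 ga1] ->]]] jf jN.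
have coefN (t : option (slot lam)) : fresh_coef N tau (key N' t) != 0 -> N' = N.
  by rewrite /fresh_coef keyK; case: (N' =P N) => // _; rewrite eqxx.
have coef_gt l : fresh_coef N tau l != 0 -> (N < l)%N.
  rewrite /fresh_coef /unkey; case E: (CodeSeq.decode l) => [|M [|q []]]; rewrite ?eqxx //.
  have := CodeSeq.gtn_decode l; rewrite E => /andP[Ml _].
  case: (unpickle q) => [t|] /=; rewrite ?eqxx //.
  by case: (M =P N) Ml => [-> //|_ _]; rewrite eqxx.
have EN : N' = N.
  have := jN _ fa0; rewrite ffunE; case: ltnP => [ltN'|_ /coefN //].
  move=> /coef_gt NN'; have := ltn_trans NN' ltN' => {}NN'.
  (* Now [N < N'], and [j a1] is a key of level [N']. It is too large to be a value of [f] below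
     [N]; otherwise its nonzero coefficient gives the level. *)
  have [fa1|fa1] := ltnP (f a1) N.
    have := jf _ fa1; rewrite ffunE ga1 ltnn => Ek.
    have := gt_key N' (Some (Tagged _ (g, a1))).
    by rewrite Ek ltnNge (ltnW (ltn_trans fa1 NN')).
  have {}fa1 : f a1 = N by apply/eqP; rewrite eqn_leq fN.
  by have := jN _ fa1; rewrite ffunE ga1 ltnn => /coefN.
rewrite {}EN {coefN} in gN ga1 jf jN *; apply: (congr1 (@skeleton r lam i N)); apply/ffunP=> a.
have [ga|ga] := ltnP (g a) N; have [fa|fa] := ltnP (f a) N.
- by rewrite -jf // ffunE ga.
- have {}fa : f a = N by apply/eqP; rewrite eqn_leq fN.
  by have := coef_gt _ (jN _ fa); rewrite ffunE ga ltnNge (ltnW ga).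
- have := jf _ fa; rewrite ffunE ltnNge ga /= => Ek.
  by have := gt_key N (Some (Tagged _ (g, a))); rewrite Ek ltnNge (ltnW fa).
- by apply: anti_leq; rewrite (leq_trans (gN a) fa) (leq_trans (fN a) ga).
Qed.

(** Only finitely many [f] have values at most [N], so [fresh_coef] can be cut off beyond their keys
    to a polynomial. By [skeleton_unique] only the term at the skeleton of [f] is left, and its
    value is [tau i f]. *)
Lemma fresh_vector N (tau : forall i, {ffun 'I_(n i) -> nat} -> k) :
  exists u : {poly k},
    (exists l, (N <= l)%N /\ u`_l = 1) /\
    forall i (f : {ffun 'I_(n i) -> nat}), (forall a, (f a <= N)%N) -> (exists a, f a = N) ->
      model_form (lam := lam) (monomial_or N u f) = tau i f.
Proof.
pose T := option {i : 'I_r & ({ffun 'I_(n i) -> 'I_N.+1} * 'I_(n i))%type}.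
pose nf i (f : {ffun 'I_(n i) -> 'I_N.+1}) : {ffun 'I_(n i) -> nat} := [ffun a => nat_of_ord (f a)].
pose cv (t : T) : option (slot lam) :=
  if t is Some (existT i (f, a)) then Some (Tagged _ (nf i f, a)) else None.
pose S := (\max_(t : T) key N (cv t)).+1.
have keyS t : (key N (cv t) < S)%N by rewrite ltnS; apply: (leq_bigmax t).
have uE t : (\poly_(l < S) fresh_coef N tau l)`_(key N (cv t)) = fresh_coef N tau (key N (cv t)).
  by rewrite coef_poly keyS.
exists (\poly_(l < S) fresh_coef N tau l); split.
  by exists (key N (cv None)); split; [exact/ltnW/gt_key | rewrite uE fresh_coef_key].
move=> i f fN [a0 fa0].
have uf a : (\poly_(l < S) fresh_coef N tau l)`_(key N (Some (Tagged _ (f, a)))) =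
    if [pick b | f b == N] == Some a then tau i f else 1.
  have ff : f = nf i [ffun a => inord (f a)].
    by apply/ffunP=> b; rewrite !ffunE inordK // ltnS.
  have := uE (Some (Tagged _ ([ffun a => inord (f a)], a))).
  by rewrite /= -ff => ->; rewrite fresh_coef_key.
rewrite /model_form (@polyform1 _ _ _ _ (skeleton N f)).
  have -> : is_skeleton (skeleton N f) by apply/asboolP; exists N, f; split=> //; exists a0.
  (* The picked place contributes [tau i f] and every other place 1. *)
  rewrite mulr1; case: pickP uf => [b /eqP fb|/(_ a0)]; last by rewrite fa0 eqxx.
  move=> uf; rewrite (bigD1 b) //= big1 => [|a ab].
    by rewrite mulr1 !ffunE fb ltnn uf eqxx.
  rewrite !ffunE; case: ltnP => _; first by rewrite coefXn eqxx.
  by rewrite uf; case: eqP => // -[E]; rewrite E eqxx in ab.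
move=> g g1 gs; apply: (skeleton_unique (tau := tau)) => //; first by exists a0.
- by move: gs; case: (is_skeleton g) => //; rewrite eqxx.
- move=> a fa; have := g1 a; rewrite ffunE fa coefXn.
  by case: (g a =P f a) => [//|_]; rewrite /= eqxx.
- move=> a fa; have := g1 a; rewrite ffunE fa ltnn coef_poly.
  by case: ifP => //; rewrite eqxx.
Qed.

End ModelExtensible.

(** * Extensibility of the model *)

Section ModelExtensible.
Variables (k : fieldType) (r : nat) (lam : r.-tuple intpart).
Local Notation n i := (sumn (tnth lam i)).
Variable c : forall i, {perm 'I_(n i)} -> tabloid (tnth lam i) -> k.
Arguments c : clear implicits.
Hypotheses (cP : forall i, splits (c i)) (G0 : forall i, #|{perm 'I_(n i)}|%:R != 0 :> k).
Arguments cP : clear implicits.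
Local Notation V0 := (model k lam).

Lemma model_form_multilinear i : multilinear idfun (model_form (k := k) (lam := lam) (i := i)).
Proof. exact: polyform_multilinear. Qed.

Lemma mf_model i (v : {ffun 'I_(n i) -> {poly k}}) :
  mf c (V := V0) v = symmetrize (c i) (model_form (lam := lam) (i := i)) v.
Proof. exact: mform_schur_form. Qed.

(** Symmetrization permutes the arguments with fixed coefficients, so it respects linear relations
    even between forms on different spaces, each with its own arguments. *)
Lemma symmetrize_decomp i (A B C D : lmodType k) (m : {ffun 'I_(n i) -> A} -> k^o)
    (m1 : {ffun 'I_(n i) -> B} -> k^o) (m2 : {ffun 'I_(n i) -> C} -> k^o)
    (m3 : {ffun 'I_(n i) -> D} -> k^o) v v1 v2 v3 :
  (forall s, m (tuple_act s v) =
     1 *: m1 (tuple_act s v1) + (-1 *: m3 (tuple_act s v3) + m2 (tuple_act s v2))) ->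
  symmetrize (c i) m v =
    1 *: symmetrize (c i) m1 v1 + (-1 *: symmetrize (c i) m3 v3 + symmetrize (c i) m2 v2).
Proof.
move=> E; rewrite /symmetrize !scaler_sumr -!big_split /=; apply: eq_bigr => g _.
rewrite !scaler_sumr -!big_split /=; apply: eq_bigr => s _.
by rewrite E !mulrDr !scale1r !scaleN1r mulrN.
Qed.

Section Extend.
Variables (W : lspace k lam) (s : seq (W * V0)) (w : W).
Hypotheses (sP : partial_isometry c s) (sw : ~ exists v, inspan s (w, v)).

(** The map [rho] extends the inverse of [s] to all polynomials. The form [m] prescribes values with
    [(1, 0)] standing for the new vector, and [fresh_vector] supplies a [u] realising them on basis
    tuples; multilinearity carries them over to the span. *)
Lemma model_extend : exists u : V0, partial_isometry c ((w, u) :: s).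
Proof.
have swapL : linear (fun p : W * V0 => (p.2 : {poly k}, p.1)) by [].
have [rho rhoP] : exists rho : {linear {poly k} -> W}, forall p, inspan s p -> rho p.2 = p.1.
  have [|f fP] := @poly_linear_extension k W [seq (p.2 : {poly k}, p.1) | p <- s].
    by move=> _ /(inspan_mapE swapL)[p /sP.1 sp ->] /= /sp.
  by exists f => p sp; have := fP _ (inspan_map swapL sp).
have [N sN] : exists N, forall p, inspan s p -> (size (p.2 : {poly k}) <= N)%N.
  have [N NP] : exists N, forall p, p \in s -> (size (p.2 : {poly k}) <= N)%N.
    elim: (s) => [|q s' [N NP]]; first by exists 0%N.
    exists (maxn (size (q.2 : {poly k})) N) => p; rewrite inE leq_max.
    by move=> /orP[/eqP ->|/NP ->]; rewrite ?leqnn ?orbT.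
  exists N => p; elim/inspan_ind => [|a q {}p qs pN]; first by rewrite size_poly0.
  apply: leq_trans (size_polyD _ _) _; rewrite geq_max pN andbT.
  exact: leq_trans (size_scale_leq _ _) (NP _ qs).
pose fW (q : k^o * {poly k}) := q.1 *: w + rho q.2.
have fWL : linear fW.
  move=> a x y; rewrite /fW /= linearP scalerDl scalerDr scalerA.
  by rewrite addrACA.
pose fR (q : k^o * {poly k}) := rho q.2.
have fRL : linear fR by move=> a x y; rewrite /fR /= linearP.
have sndL : linear (snd : k^o * {poly k} -> {poly k}) by [].
(* m extends the model form, whereas only its first term is prescribed; the
   difference of the two other terms is killed by symmetrization on the span
   of s, since rho is isometric there. *)
pose m i (q : {ffun 'I_(n i) -> k^o * {poly k}}) : k^o :=
  1 *: mf c [ffun a => fW (q a)] +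
  (-1 *: mf c [ffun a => fR (q a)] + model_form (lam := lam) [ffun a => (q a).2]).
have mP i : multilinear idfun (@m i).
  apply: multilinear_lin.
    exact: (multilinear_comp (m := mf c (V := W) (i := i)) fWL
      (mf_multilinear c (V := W) (i := i))).
  apply: multilinear_lin.
    exact: (multilinear_comp (m := mf c (V := W) (i := i)) fRL
      (mf_multilinear c (V := W) (i := i))).
  exact: (multilinear_comp (m := model_form (lam := lam) (i := i)) sndL
    (@model_form_multilinear i)).
pose bt i (f : {ffun 'I_(n i) -> nat}) : {ffun 'I_(n i) -> k^o * {poly k}} :=
  [ffun a => if (f a < N)%N then (0, 'X^(f a)) else (1, 0)].
have [u [[l [Nl ul]] uP]] := @fresh_vector k r lam N (fun i f => m i (bt i f)).
have uPm i (f : {ffun 'I_(n i) -> nat}) : (forall a, (f a <= N)%N) ->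
    model_form (monomial_or N u f) = m i (bt i f).
  (* Without a new place [fW] and [fR] agree, and [m] reduces to the model form. *)
  move=> fN; have [ex|nex] := pselect (exists a, f a = N); first exact: uP.
  have fltN a : (f a < N)%N.
    by rewrite ltn_neqAle fN andbT; apply/eqP => fa; apply: nex; exists a.
  rewrite /m scale1r scaleN1r addrA.
  have -> : [ffun a => fW (bt i f a)] = [ffun a => fR (bt i f a)].
    by apply/ffunP=> a; rewrite !ffunE fltN /fW /= scale0r add0r.
  rewrite subrr add0r; congr model_form.
  by apply/ffunP=> a; rewrite !ffunE fltN.
(* The graph of the linear map fixing the monomials below ['X^N] and sending the new basis vector
   [(1, 0)] to [u]. *)
pose L : seq ((k^o * {poly k}) * {poly k}) :=
  ((1, 0), u) :: mkseq (fun j => ((0, 'X^j), 'X^j)) N.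
have LE i (v : {ffun 'I_(n i) -> (k^o * {poly k}) * {poly k}}) : (forall a, inspan L (v a)) ->
    m i [ffun a => (v a).1] = model_form (lam := lam) [ffun a => (v a).2].
  apply: multilinear_span_eq => //; first exact: model_form_multilinear.
  move=> {}v vL.
  have /choice[f fP] : forall a, exists j, (j <= N)%N /\
      v a = if (j < N)%N then ((0, 'X^j), 'X^j) else ((1, 0), u).
    move=> a; have := vL a; rewrite inE => /orP[/eqP ->|/mapP[j jN ->]].
      by exists N; rewrite leqnn ltnn.
    by move: jN; rewrite mem_iota add0n /= => jN; exists j; rewrite (ltnW jN) jN.
  have fN a : ([ffun a => f a] a <= N)%N by rewrite ffunE; have [] := fP a.
  refine (etrans (congr1 (@m i) _) (etrans (esym (uPm i _ fN)) (congr1 (@model_form _ _ _ i) _)));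
  by apply/ffunP=> a; rewrite !ffunE; have [_ ->] := fP a; case: ifP.
have XL (x : {poly k}) : (size x <= N)%N -> inspan L ((0, x), x).
  move=> xN; have -> : ((0, x), x) =
    \sum_(j < N) x`_j *: ((0 : k^o, 'X^j : {poly k}), 'X^j : {poly k}).
    rewrite [RHS]surjective_pairing (raddf_sum fst) (raddf_sum snd) /=.
    rewrite -(poly_sum_monomials xN); congr (_, _).
    rewrite [RHS]surjective_pairing (raddf_sum fst) (raddf_sum snd) /=.
    by rewrite -(poly_sum_monomials xN) big1 // => j _; rewrite scaler0.
  apply: inspan_sum => j _; apply/inspan_mem; rewrite inE; apply/orP; right.
  by apply: (map_f (fun j => ((0, 'X^j), 'X^j))); rewrite mem_iota add0n ltn_ord.
have uL : inspan L ((1, 0), u) by apply: inspan_head.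
exists u; split=> [p [a ap]|i v sv].
  have [q [sq ->]] : exists q, inspan s q /\ p = a *: (w, u) + q.
    by exists (p - a *: (w, u)); split=> //; rewrite addrC subrK.
  have q2N := sN _ sq; split=> /= E.
    have [a0|a0] := eqVneq a 0.
      by move: E; rewrite a0 !scale0r !add0r; apply: (proj1 (sP.1 q sq)).
    (* With [a] nonzero, [w] would lie in the domain of [s]. *)
    case: sw; exists (- a^-1 *: q.2).
    have := inspan_lin (- a^-1) sq (inspan0 _); rewrite addr0.
    suff -> : - a^-1 *: q = (w, - a^-1 *: q.2) by [].
    rewrite [LHS]surjective_pairing /=; congr (_, _).
    have -> : q.1 = - (a *: w) by apply/eqP; rewrite -addr_eq0 addrC E.
    by rewrite scaleNr scalerN opprK scalerA mulVf ?scale1r.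
  (* At ['X^l], where [l] is at least [N], [u] has coefficient 1 and [q.2] has coefficient 0. *)
  have a0 : a = 0.
    have := congr1 (fun x : {poly k} => x`_l) E; rewrite coefD coefZ ul mulr1 coef0.
    by rewrite nth_default ?addr0 // (leq_trans q2N).
  by move: E; rewrite a0 !scale0r !add0r; apply: (proj2 (sP.1 q sq)).
have [b bP] := choice sv.
have [q [sq vE]] : exists q : 'I_(n i) -> W * V0,
    (forall a, inspan s (q a)) /\ forall a, v a = b a *: (w, u) + q a.
  exists (fun a => v a - b a *: (w, u)); split=> [|a]; first exact: bP.
  by rewrite addrC subrK.
have v1 a : (v a).1 = b a *: w + (q a).1 by rewrite vE.
have v2 a : (v a).2 = b a *: u + (q a).2 by rewrite vE.
rewrite mf_model; apply/esym.
rewrite (@symmetrize_decomp i _ _ _ _ _ (mf c (V := W) (i := i)) (model_form (lam := lam) (i := i))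
  (mf c (V := W) (i := i)) _ [ffun a => (v a).1] [ffun a => (q a).2] [ffun a => (q a).1]).
  rewrite -mf_model !symmetrize_mform // -!/(mf _ _).
  have -> : mf c (V := V0) [ffun a => (q a).2] = mf c [ffun a => (q a).1].
    have {}sq a : inspan s ([ffun a => q a] a) by rewrite ffunE.
    refine (etrans (congr1 (mf c (V := V0) (i := i)) _) (etrans (esym (sP.2 i _ sq))
      (congr1 (mf c (V := W) (i := i)) _))); by apply/ffunP=> a; rewrite !ffunE.
  by rewrite scale1r scaleN1r addNr addr0.
(* This is [LE], since [fW] sends [(b a, (q a).2)] to [(v a).1] and [fR] sends it to [(q a).1]. *)
move=> g; pose y : {ffun 'I_(n i) -> (k^o * {poly k}) * {poly k}} :=
  tuple_act g [ffun a => ((b a, (q a).2), (v a).2)].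
have /LE : forall a, inspan L (y a).
  move=> a; rewrite !ffunE v2.
  set a' := (g^-1)%g a; have := inspan_lin (b a') uL (XL _ (sN _ (sq a'))).
  suff -> : b a' *: ((1, 0), u) + ((0, (q a').2), (q a').2) =
    ((b a', (q a').2), b a' *: u + (q a').2) :> (k^o * {poly k}) * {poly k} by [].
  congr (_, _, _); first by rewrite /= addr0; apply: mulr1.
  by rewrite /= scaler0 add0r.
have -> : [ffun a => (y a).2] = tuple_act g [ffun a => (v a).2] by apply/ffunP=> a; rewrite !ffunE.
move=> <-; rewrite /m.
have -> : [ffun a => fW ([ffun a => (y a).1] a)] = tuple_act g [ffun a => (v a).1].
  by apply/ffunP=> a; rewrite !ffunE /fW /= rhoP ?v1.
have -> : [ffun a => fR ([ffun a => (y a).1] a)] = tuple_act g [ffun a => (q a).1].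
  by apply/ffunP=> a; rewrite !ffunE /fR /= rhoP.
have -> // : [ffun a => ([ffun a => (y a).1] a).2] = tuple_act g [ffun a => (q a).2].
by apply/ffunP=> a; rewrite !ffunE.
Qed.

End Extend.

Lemma model_extensible : extensible c V0.
Proof.
move=> W s w sP; have [[v sv]|nw] := pselect (exists v, inspan s (w, v)); last exact: model_extend.
exists v; apply: (partial_isometry_sub sP) => p [a sp].
by rewrite -(subrK (a *: (w, v)) p) addrC; apply: inspan_lin.
Qed.

Lemma model_countable : countable_dim V0.
Proof.
exists (fun i => 'X^i : {poly k}); split=> [v|m b E i im].
  exists (size (v : {poly k})), (fun i => (v : {poly k})`_i).
  exact: poly_sum_monomials.
have := congr1 (fun p : {poly k} => p`_i) E.
rewrite coef0 -poly_def coef_poly im; exact.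
Qed.

End ModelExtensible.

(** * Extension of scalars *)

Section ScalarExtensionForms.
Variables (k k' : fieldType) (h : {rmorphism k -> k'}).

Section Splitting.
Variable lam : intpart.
Local Notation n := (sumn lam).
Variable c : {perm 'I_n} -> tabloid lam -> k.
Local Notation hc := (fun s t => h (c s t)).

Lemma tabloid_form_scext s (x : tabloid_space k lam) :
  tabloid_form hc s (tabloid_scext h x) = h (tabloid_form c s x).
Proof.
by rewrite /tabloid_form rmorph_sum; apply: eq_bigr => t _; rewrite ffunE rmorphM.
Qed.

(** Polytabloids have integer coefficients, so base change carries those over [k] to those over
    [k'], together with the splitting identity. *)
Lemma splits_scext : splits c -> splits hc.
Proof.
move=> cP s0; rewrite -(tabloid_scext_poly h s0) [in LHS]cP.
apply/ffunP=> t; rewrite ffunE !sum_ffunE rmorph_sum; apply: eq_bigr => s _.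
rewrite tabloid_form_scext -(tabloid_scext_poly h s) !ffunE.
exact: rmorphM.
Qed.

Lemma tpow_scext_sum (V : lmodType k) (I : finType) (a : I -> k) (t : I -> tpow n V) :
  tpow_scext h (\sum_i a i *: t i) = \sum_i h (a i) *: tpow_scext h (t i).
Proof.
have tL := @tpow_scext_semilinear k k' h V n.
elim/big_rec2: _ => [|i y z _ <-]; last by rewrite tL.
exact: semilinear0 tL.
Qed.

Lemma tpow_scext_act (V : lmodType k) s (t : tpow n V) :
  tpow_scext h (tpow_act s t) = tpow_act s (tpow_scext h t).
Proof.
have tL := @tpow_scext_semilinear k k' h V n.
have t0 : tpow_scext h (0 : tpow n V) = 0.
  exact: semilinear0 tL.
elim/tens_ind: t => [|v|a x y Ex Ey]; first by rewrite t0 !linear0 t0.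
  rewrite tpow_act_tens !tpow_scext_tens tpow_act_tens; congr tens.
  by apply/ffunP=> j; rewrite !ffunE.
by rewrite linearP !tL Ex Ey linearP.
Qed.

(** All ingredients of the projection commute with base change once the matrix is mapped by [h].
    This produces pairs in the relation [schur_scext] on which extended structures can be
    compared. *)
Lemma schur_proj_scext (V : lmodType k) (t : tpow n V) :
  schur_scext (schur_proj c t) (schur_proj hc (tpow_scext h t)).
Proof.
move=> x; rewrite !schur_projE /schur_proj_fun.
have tL a (u : tpow n V) : tpow_scext h (a *: u) = h a *: tpow_scext h u.
  have := tpow_scext_sum (fun _ : 'I_1 => a) (fun=> u); by rewrite !big_ord1.
rewrite tL fmorphV rmorph_nat; congr (_ *: _).
rewrite !pair_big /= tpow_scext_sum; apply: eq_bigr => -[g s] _ /=.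
rewrite tpow_scext_act -tabloid_form_scext; congr (tabloid_form _ _ _ *: _).
by rewrite specht_scextE; apply/ffunP=> u; rewrite !ffunE.
Qed.

Lemma specht_scext_gen : specht_scext h (specht_gen k lam) = specht_gen k' lam.
Proof.
have gen (K : fieldType) : polytabloid K 1 \in specht K lam.
  by apply: memv_span; apply: image_f.
have E (K : fieldType) : vsval (specht_gen K lam) = polytabloid K 1 by exact: vsprojK (gen K).
apply/val_inj; transitivity (vsval (specht_gen k' lam)) => //.
rewrite [LHS]specht_scextE !E.
exact: (tabloid_scext_poly h 1%g).
Qed.

End Splitting.

Lemma scext_span (V : lmodType k) (p : scext h V) :
  exists t : seq V, inspan (map (scext_in h (V := V)) t) p.
Proof.
elim/scext_ind: p => [|v|a x y [t tx] [u uy]]; first by exists [::].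
  by exists [:: v]; apply: inspan_head.
exists (t ++ u); rewrite map_cat; apply: inspan_lin.
  by apply: inspan_sub tx => q qt; apply: inspan_mem; rewrite mem_cat qt.
by apply: inspan_sub uy => q qt; apply: inspan_mem; rewrite mem_cat qt orbT.
Qed.

(** The vectors [scext_in h v] span the base change, so [multilinear_span] applies to the
    difference. *)
Lemma multilinear_scext_eq n (V : lmodType k) (m m' : {ffun 'I_n -> scext h V} -> k'^o) :
  multilinear idfun m -> multilinear idfun m' ->
  (forall v : {ffun 'I_n -> V}, m [ffun a => scext_in h (v a)] = m' [ffun a => scext_in h (v a)]) ->
  m =1 m'.
Proof.
move=> mP mP' E v; have [t tP] := choice (fun a => scext_span (v a)).
apply/eqP; rewrite -subr_eq0 addrC -scaleN1r; apply/eqP.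
apply: (multilinear_span (m := fun v => -1 *: m' v + m v)
  (s := map (scext_in h (V := V)) (flatten (codom t)))) => [|u us|a].
- exact: multilinear_lin.
- have [x xP] : exists x : {ffun 'I_n -> V}, u = [ffun a => scext_in h (x a)].
    have /choice[x xP] : forall a, exists x, u a = scext_in h x.
      by move=> a; have /mapP[x _ ->] := us a; exists x.
    by exists [ffun a => x a]; apply/ffunP=> a; rewrite !ffunE xP.
  by rewrite xP E scaleN1r addNr.
- apply: inspan_sub (tP a) => q /mapP[x xt ->]; apply/inspan_mem/map_f.
  by apply/flattenP; exists (t a); first exact: codom_f.
Qed.

(** * Base change of a lambda-structure *)

Section Structures.
Variables (r : nat) (lam : r.-tuple intpart).
Local Notation n i := (sumn (tnth lam i)).
Variable c : forall i, {perm 'I_(n i)} -> tabloid (tnth lam i) -> k.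
Arguments c : clear implicits.
Hypotheses (cP : forall i, splits (c i)) (G0 : forall i, #|{perm 'I_(n i)}|%:R != 0 :> k).
Arguments cP : clear implicits.

(** By [mform_inj] over [k'] and multilinearity, it suffices to compare at projected pure tensors
    coming from [V], where both values are the image under [h] of the value over [k]. *)
Lemma scext_structure_unique (V : lspace k lam) (w w' : lstructure lam (scext h V)) :
  scext_structure h (omega V) w -> scext_structure h (omega V) w' -> forall i, w i =1 w' i.
Proof.
move=> wP wP' i; have G0' : #|{perm 'I_(n i)}|%:R != 0 :> k'.
  by rewrite -(rmorph_nat h) fmorph_eq0.
apply: (mform_inj (splits_scext (cP i)) G0').
apply: multilinear_scext_eq; [exact: mform_multilinear|exact: mform_multilinear|].
move=> v; rewrite /mform -tpow_scext_tens.
have S := schur_proj_scext (c i) (tens v).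
by rewrite (wP i _ _ S) (wP' i _ _ S).
Qed.

Section FromModel.
Variables (V : lspace k lam) (f : {linear V -> model k lam}).
Hypothesis fP : isomorphism f.

Definition scext_model_fun (v : V) : {poly k'} := map_poly h (f v : {poly k}).

Lemma scext_model_semilinear a x y :
  scext_model_fun (a *: x + y) = h a *: scext_model_fun x + scext_model_fun y.
Proof. by rewrite /scext_model_fun linearP raddfD /= map_polyZ. Qed.

Definition scext_model : scext h V -> {poly k'} := scext_lift (h := h) scext_model_fun.

HB.instance Definition _ := GRing.isLinear.Build k' (scext h V) {poly k'} _ scext_model
  (scext_lift_linear scext_model_semilinear).

Lemma scext_model_in v : scext_model (scext_in h v) = map_poly h (f v : {poly k}).
Proof. exact: scext_lift_in scext_model_semilinear v. Qed.

Lemma scext_model_bij : bijective scext_model.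
Proof.
have [[g fK gK] _] := fP.
(* The inverse sends ['X^i] to the base change of its preimage [g 'X^i]. *)
pose G (p : {poly k'}) : scext h V := \sum_(i < size p) p`_i *: scext_in h (g 'X^i).
have GE N (p : {poly k'}) : (size p <= N)%N -> G p = \sum_(i < N) p`_i *: scext_in h (g 'X^i).
  move=> pN; rewrite /G (big_ord_widen N (fun i => p`_i *: scext_in h (g 'X^i))) //.
  rewrite [RHS](bigID (fun i : 'I_N => (i < size p)%N)) /= [X in _ = _ + X]big1 ?addr0 // => i.
  by rewrite -leqNgt => pi; rewrite nth_default ?scale0r.
have GL a p q : G (a *: p + q) = a *: G p + G q.
  pose N := maxn (size p) (size q).
  rewrite !(@GE N) ?leq_maxl ?leq_maxr //; last first.
    apply: leq_trans (size_polyD _ _) _; rewrite geq_max leq_maxr andbT.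
    exact: leq_trans (size_scale_leq _ _) (leq_maxl _ _).
  rewrite scaler_sumr -big_split; apply: eq_bigr => i _ /=.
  by rewrite coefD coefZ scalerDl scalerA.
exists G => [x|p].
  elim/scext_ind: x => [|v|a x y Ex Ey].
  - by rewrite linear0 /G size_poly0 big_ord0.
  - rewrite scext_model_in (GE (size (f v : {poly k}))) ?size_map_poly //.
    have sL := @scext_in_semilinear k k' h V.
    have s0 : scext_in h (0 : V) = 0.
      exact: semilinear0 sL.
    transitivity (scext_in h (\sum_(i < size (f v : {poly k})) (f v : {poly k})`_i *: g 'X^i)).
      elim/big_rec2: _ => [|i x y _ ->]; first by rewrite s0.
      by rewrite sL coef_map.
    congr scext_in; apply: (can_inj fK); rewrite linear_sum.
    rewrite [RHS](poly_sum_monomials (leqnn (size (f v : {poly k})))).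
    by apply: eq_bigr => i _; rewrite linearZ /= gK.
  - by rewrite linearP GL Ex Ey.
rewrite /G linear_sum [RHS](poly_sum_monomials (leqnn _)); apply: eq_bigr => i _.
by rewrite linearZ /= scext_model_in gK map_polyXn.
Qed.

Definition scext_model_structure : lstructure lam (scext h V) :=
  pullback (scext_model : {linear scext h V -> model k' lam}) (omega (model k' lam)).

(** Both models take the same values 0 and 1 at tuples of monomials, and [h] preserves these;
    [polyform_map] then settles pure tensors, and the Specht generators correspond under base
    change. *)
Lemma scext_model_structureP : scext_structure h (omega V) scext_model_structure.
Proof.
move=> i p p' pp'.
have E (t : tpow (n i) V) :
    tpow_lift idfun (model_form (k := k') (lam := lam) (i := i))
      (tpow_map scext_model (tpow_scext h t)) =
    h (tpow_lift idfun (model_form (k := k) (lam := lam) (i := i)) (tpow_map f t)).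
  have mP := @model_form_multilinear k r lam i.
  have mP' := @model_form_multilinear k' r lam i.
  have tL := @tpow_scext_semilinear k k' h V (n i).
  have t0 : tpow_scext h (0 : tpow (n i) V) = 0.
    exact: semilinear0 tL.
  have l0 : tpow_lift idfun (model_form (k := k) (lam := lam) (i := i)) 0 = 0.
    exact: semilinear0 (tpow_lift_semilinear mP).
  have l0' : tpow_lift idfun (model_form (k := k') (lam := lam) (i := i)) 0 = 0.
    exact: semilinear0 (tpow_lift_semilinear mP').
  elim/tens_ind: t => [|v|a x y Ex Ey].
  - by rewrite t0 !linear0 l0 l0' rmorph0.
  - rewrite tpow_scext_tens !tpow_map_tens !tpow_lift_tens //.
    rewrite -polyform_map; congr polyform.
      by apply/funext=> j; rewrite rmorph_nat.
    by apply/ffunP=> a; rewrite !ffunE; exact: scext_model_in.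
  - have -> : tpow_scext h (a *: x + y) = h a *: tpow_scext h x + tpow_scext h y by exact: tL.
    rewrite !linearP (tpow_lift_semilinear mP') (tpow_lift_semilinear mP) Ex Ey.
    by rewrite rmorphD rmorphM.
have [_ [_ fE]] := fP; rewrite -(fE i p).
change (tpow_lift idfun (model_form (k := k') (lam := lam) (i := i))
    (tpow_map scext_model (val p' (specht_gen k' (tnth lam i)))) =
  h (tpow_lift idfun (model_form (k := k) (lam := lam) (i := i))
    (tpow_map f (val p (specht_gen k (tnth lam i)))))).
rewrite -(specht_scext_gen (tnth lam i)) pp'; exact: E.
Qed.

Lemma scext_isomorphism (w : lstructure lam (scext h V)) :
  scext_structure h (omega V) w ->
  exists F : {linear LSpace w -> model k' lam}, isomorphism F.
Proof.
move=> wP; exists (scext_model : {linear scext h V -> model k' lam}).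
split; first exact: scext_model_bij.
split; first exact: bij_inj scext_model_bij.
by move=> i; apply: (scext_structure_unique scext_model_structureP wP).
Qed.

End FromModel.
End Structures.
End ScalarExtensionForms.

(** * Existence, uniqueness and base change of universal homogeneous spaces *)

Lemma sumn_intpart_gt0 (lam : intpart) : parts lam <> [::] -> (0 < sumn lam)%N.
Proof.
case: lam => [[|[|m] s] /= lamP] // _.
by rewrite andbF in lamP.
Qed.

(** The averaging divides by the order of the symmetric group, which is where characteristic 0
    enters. *)
Lemma card_perm_neq0 (k : fieldType) n : [pchar k] =i pred0 -> #|{perm 'I_n}|%:R != 0 :> k.
Proof.
move=> char0; by rewrite (proj1 (pcharf0P k) char0) -lt0n; apply/card_gt0P; exists 1%g.
Qed.

Theorem theorem3p8 (k : fieldType) (char0 : [pchar k] =i pred0)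
    (r : nat) (lam : r.-tuple intpart)
    (pure : forall i : 'I_r, parts (tnth lam i) <> [::]) :
  (exists V : lspace k lam,
     countable_dim V /\ universal V /\ homogeneous V) /\
  (forall V V' : lspace k lam,
     countable_dim V -> universal V -> homogeneous V ->
     countable_dim V' -> universal V' -> homogeneous V' ->
     exists f : {linear V -> V'}, isomorphism f) /\
  (forall V : lspace k lam,
     countable_dim V -> universal V -> homogeneous V ->
     forall (k' : fieldType) (h : {rmorphism k -> k'}),
       (exists w, scext_structure h (omega V) w) /\
       (forall w, scext_structure h (omega V) w ->
          universal (LSpace w) /\ homogeneous (LSpace w))).
Proof.
have n_gt0 i : (0 < sumn (tnth lam i))%N by apply/sumn_intpart_gt0/pure.
pose c i := projT1 (cid (splits_exists k (tnth lam i))).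
have cP i : splits (c i) by exact: projT2 (cid (splits_exists k (tnth lam i))).
have G0 i : #|{perm 'I_(sumn (tnth lam i))}|%:R != 0 :> k by exact: card_perm_neq0.
have M_ext := model_extensible cP G0.
have M_dim := model_countable k lam.
have M_span := countable_dim_spanned M_dim.
have ext V Vu Vh := @universal_homogeneous_extensible _ _ _ _ cP G0 V Vu Vh.
split; [|split].
- exists (model k lam); split=> //.
  split; first exact: extensible_universal cP G0 n_gt0 _ M_ext.
  exact: extensible_homogeneous cP G0 _ M_ext M_span.
- move=> V V' /countable_dim_spanned Vc Vu Vh /countable_dim_spanned Vc' Vu' Vh'.
  exact: (extensible_isomorphic cP G0 n_gt0 (ext _ Vu Vh) (ext _ Vu' Vh')).
move=> V /countable_dim_spanned Vc Vu Vh k' h.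
(* Since [V] is isomorphic to the model over [k], each extended structure on its base change is
   isomorphic to the model over [k'], which is again extensible. *)
have [f fP] := extensible_isomorphic cP G0 n_gt0 (ext _ Vu Vh) M_ext Vc M_span.
split=> [|w wP]; first by exists (scext_model_structure h f); apply: scext_model_structureP.
pose c' i s t := h (c i s t).
have cP' i : splits (c' i) by exact: splits_scext.
have G0' i : #|{perm 'I_(sumn (tnth lam i))}|%:R != 0 :> k'.
  by rewrite -(rmorph_nat h) fmorph_eq0.
have [F FP] := scext_isomorphism cP G0 fP wP.
have w_ext := extensible_iso cP' G0' FP (model_extensible cP' G0').
have w_span := countably_spanned_iso FP.1 (countable_dim_spanned (model_countable k' lam)).
split; first exact: extensible_universal cP' G0' n_gt0 _ w_ext.
exact: extensible_homogeneous cP' G0' _ w_ext w_span.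
Qed.
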